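(* Let $\hbar,M,k>0$ be real constants and, for $0\le\delta\le\frac12$, let $$\mathcal J(x,y,\delta)=\frac{\hbar k}{M}\left(-1+\frac{\delta}{k}\,\frac{y}{x^2+y^2},\; -\frac{\delta}{k}\,\frac{x}{x^2+y^2}\right)$$ on $\mathbb R^2\setminus\{(0,0)\}$ (for $\delta=0$ this is the constant field $(-\hbar k/M,0)$, considered on all of $\mathbb R^2$). Then the family of complex analytic functions $$F(z,\delta)=\frac{\hbar k}{M}\left(-z+i\,\frac{\delta}{k}\log z\right),\qquad z=x+iy,$$ is the family of complex potentials of the flow of $\mathcal J(\cdot,\cdot,\delta)$, and the flow of $\mathcal J$ is as follows. (1) If $\delta=0$, the flow is parallel: the streamlines are the horizontal lines $y=c_0$, $c_0\in\mathbb R$, and the velocity is constant, equal to $(-\hbar k/M,0)$ (uniform flow to the left). (2) If $\delta>0$, let $\psi(x,y,\delta)=\frac{\hbar k}{M}\left(-y+\frac{\delta}{k}\log\sqrt{x^2+y^2}\right)$ be the stream function. The streamlines are contained in the level curves of $\psi(\cdot,\cdot,\delta)$ and the collection of streamlines is symmetric with respect to the $y$-axis. There is exactly one stagnation point, $z_0=i\,\delta/k$, i.e. the point $(0,\delta/k)$, and it is a saddle. The separatrices of $z_0$ are subsets of the level curve $$L(\delta)=\left\{(x,y)\in\mathbb R^2\setminus\{(0,0)\} : \psi(x,y,\delta)=\frac{\hbar\delta}{M}\left(\log\frac{\delta}{k}-1\right)\right\}.$$ There is a homoclinic streamline of $z_0$ which, together with $z_0$, forms a closed curve bounding a neighborhood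 of the origin, and this neighborhood, with the origin removed, is filled with cycles (closed streamlines) surrounding the vortex $(0,0)$.
   Context: For a planar velocity field $q=(u,v)$ on an open set, a complex potential of $q$ is a complex analytic function $F=\phi+i\psi$ with $F'(z)=u(x,y)-i\,v(x,y)$, $z=x+iy$. Here $F$ may be multivalued because of $\log$: it is understood on any domain on which a branch of $\log$ is chosen, while $F'$ is single-valued on $\mathbb C\setminus\{0\}$. The imaginary part $\psi$ is called the stream function (for the $F$ of the claim it is single-valued). The streamlines are the integral curves of $q$, which lie on level curves of $\psi$. A stagnation point is a point $z$ with $F'(z)=0$, equivalently a zero of $q$. The separatrices of a saddle stagnation point are the nonconstant streamlines that tend to it in forward or backward time; a streamline is homoclinic to it if it tends to it both in forward and in backward time. $\mathbb R^2$ is identified with $\mathbb C$ via $z=x+iy$. *)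

(* Defs.v *)
From Stdlib Require Import Reals.
From Coquelicot Require Export Coquelicot.

Open Scope R_scope.

(* The plane R^2 is Coquelicot's C, which is R * R by definition; its elements
   serve both as points and as vectors.  Coquelicot gives C two normed module
   structures: C_NormedModule over C_AbsRing (complex derivatives) and
   C_R_NormedModule over R_AbsRing (real derivatives of planar maps). *)

Definition connected (U : C -> Prop) : Prop :=
  forall A B : C -> Prop,
    open A -> open B ->
    (forall z, U z -> A z \/ B z) ->
    (exists z, U z /\ A z) -> (exists z, U z /\ B z) ->
    exists z, U z /\ A z /\ B z.

Definition is_bounded (U : C -> Prop) : Prop :=
  exists r : R, forall z, U z -> Cmod z <= r.

Definition boundary (U : C -> Prop) (z : C) : Prop :=
  forall V : C -> Prop, locally z V ->
    (exists w, V w /\ U w) /\ (exists w, V w /\ ~ U w).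

Definition simple_closed_curve (S : C -> Prop) : Prop :=
  exists c : R -> C,
    continuous_on (fun s => 0 <= s <= 1) c /\
    c 0 = c 1 /\
    (forall s t, 0 <= s < 1 -> 0 <= t < 1 -> c s = c t -> s = t) /\
    (forall z, S z <-> exists s, 0 <= s <= 1 /\ z = c s).

(* An open connected set whose boundary is S is a connected component of the
   complement of S, so W is a bounded component of that complement. *)
Definition bounds (S W : C -> Prop) : Prop :=
  open W /\ connected W /\ is_bounded W /\ (forall z, boundary W z <-> S z).

Definition surrounds (S : C -> Prop) (z : C) : Prop :=
  exists W : C -> Prop, bounds S W /\ W z.

Definition Cexp (z : C) : C :=
  (exp (Re z) * cos (Im z), exp (Re z) * sin (Im z)).

(* The equation forces 0 to lie outside U. *)
Definition log_branch (U : C -> Prop) (lg : C -> C) : Prop :=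
  open U /\ connected U /\ continuous_on U lg /\
  (forall z, U z -> Cexp (lg z) = z).

(* Analytic on the open set U is complex differentiable at every point of U. *)
Definition complex_potential
    (U : C -> Prop) (q : C -> C) (F : C -> C) : Prop :=
  open U /\
  forall z, U z ->
    @is_derive C_AbsRing C_NormedModule F z (fst (q z), - snd (q z)).

(* Solutions are functions on R of which only the restriction to the open
   interval ]a, b[ matters. *)
Definition integral_curve
    (D : C -> Prop) (q : C -> C) (a b : Rbar) (g : R -> C) : Prop :=
  Rbar_lt a b /\
  forall t : R, Rbar_lt a t -> Rbar_lt t b ->
    D (g t) /\ @is_derive R_AbsRing C_R_NormedModule g t (q (g t)).

Definition maximal_integral_curve
    (D : C -> Prop) (q : C -> C) (a b : Rbar) (g : R -> C) : Prop :=
  integral_curve D q a b g /\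
  forall (a' b' : Rbar) (h : R -> C),
    Rbar_le a' a -> Rbar_le b b' ->
    integral_curve D q a' b' h ->
    (forall t : R, Rbar_lt a t -> Rbar_lt t b -> h t = g t) ->
    a' = a /\ b' = b.

Definition trace (a b : Rbar) (g : R -> C) (z : C) : Prop :=
  exists t : R, Rbar_lt a t /\ Rbar_lt t b /\ z = g t.

Definition nonconstant (a b : Rbar) (g : R -> C) : Prop :=
  exists s t : R,
    Rbar_lt a s /\ Rbar_lt s b /\ Rbar_lt a t /\ Rbar_lt t b /\ g s <> g t.

Definition tends_forward (a b : Rbar) (g : R -> C) (p : C) : Prop :=
  forall V : C -> Prop, locally p V ->
    exists t0 : R, Rbar_lt a t0 /\ Rbar_lt t0 b /\
      forall t : R, t0 < t -> Rbar_lt t b -> V (g t).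

Definition tends_backward (a b : Rbar) (g : R -> C) (p : C) : Prop :=
  forall V : C -> Prop, locally p V ->
    exists t0 : R, Rbar_lt a t0 /\ Rbar_lt t0 b /\
      forall t : R, Rbar_lt a t -> t < t0 -> V (g t).

(* A streamline is taken to be the point set swept by a maximal solution. *)
Definition streamline (D : C -> Prop) (q : C -> C) (S : C -> Prop) : Prop :=
  exists (a b : Rbar) (g : R -> C),
    maximal_integral_curve D q a b g /\
    (forall z, S z <-> trace a b g z).

Definition cycle (D : C -> Prop) (q : C -> C) (S : C -> Prop) : Prop :=
  exists (g : R -> C) (T : R),
    maximal_integral_curve D q m_infty p_infty g /\
    nonconstant m_infty p_infty g /\
    0 < T /\ (forall t, g (t + T) = g t) /\
    (forall z, S z <-> trace m_infty p_infty g z).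

Definition separatrix
    (D : C -> Prop) (q : C -> C) (p : C) (S : C -> Prop) : Prop :=
  exists (a b : Rbar) (g : R -> C),
    maximal_integral_curve D q a b g /\
    nonconstant a b g /\
    (tends_forward a b g p \/ tends_backward a b g p) /\
    (forall z, S z <-> trace a b g z).

Definition homoclinic_streamline
    (D : C -> Prop) (q : C -> C) (p : C) (S : C -> Prop) : Prop :=
  exists (a b : Rbar) (g : R -> C),
    maximal_integral_curve D q a b g /\
    nonconstant a b g /\
    tends_forward a b g p /\ tends_backward a b g p /\
    (forall z, S z <-> trace a b g z).

Definition stagnation_point (D : C -> Prop) (q : C -> C) (p : C) : Prop :=
  D p /\ q p = RtoC 0.

Definition saddle (D : C -> Prop) (q : C -> C) (p : C) : Prop :=
  stagnation_point D q p /\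
  exists A : C -> C,
    @filterdiff R_AbsRing C_R_NormedModule C_R_NormedModule q (locally p) A /\
    exists (l m : R) (v w : C),
      l < 0 < m /\ v <> RtoC 0 /\ w <> RtoC 0 /\
      A v = (l * fst v, l * snd v) /\
      A w = (m * fst w, m * snd w).

(* At (0,0), for delta = 0, the formula below also gives (- hbar k / M, 0). *)
Definition current (hbar M k delta : R) (p : C) : C :=
  let x := fst p in
  let y := snd p in
  (hbar * k / M * (- 1 + delta / k * (y / (x ^ 2 + y ^ 2))),
   hbar * k / M * (- (delta / k) * (x / (x ^ 2 + y ^ 2)))).

Definition current_domain (delta : R) (p : C) : Prop :=
  delta = 0 \/ p <> RtoC 0.

(* lg is the chosen branch of the logarithm. *)
Definition potential (hbar M k delta : R) (lg : C -> C) (z : C) : C :=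
  (RtoC (hbar * k / M) * (- z + Ci * RtoC (delta / k) * lg z))%C.

Definition stream_function (hbar M k delta : R) (p : C) : R :=
  let x := fst p in
  let y := snd p in
  hbar * k / M * (- y + delta / k * ln (sqrt (x ^ 2 + y ^ 2))).

Definition separatrix_level (hbar M k delta : R) (p : C) : Prop :=
  p <> RtoC 0 /\
  stream_function hbar M k delta p = hbar * delta / M * (ln (delta / k) - 1).

(* Main.v *)
Require Import Defs.
From Stdlib Require Import Reals Lra Psatz Classical ClassicalEpsilon.
From Coquelicot Require Import Coquelicot.

(** Write [kap = hbar k / M] and [a = delta / k].  The field is the conjugate of
    [kap (- 1 + i a / z)], the derivative of [kap (- z + i a log z)]; a branch of
    the logarithm is differentiable because it is a continuous inverse of the
    exponential ([is_derive_log_branch]).  The stagnation point is the zero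
    [i a] of that derivative, which is simple, so the conjugation makes it a
    saddle: the linear part is [h |-> conj (i kap h / a)].

    The stream function [kap (- y + a ln r)] is a first integral.  Cut at the
    height [y <= a], its levels are the curves [r = a m exp (y / a)] with
    [0 < m <= 1 / e] ([rim]); [m = 1 / e] is the level of the stagnation point.
    On the ray of direction [(c, s)] the quantity [Y = y / a] satisfies
    [Y exp (- Y) = m s], which has exactly one solution [Y <= 1], namely
    [lambert (m s)].  Hence each rim is a closed curve, parametrized by its
    direction, and it bounds the region [r < a m exp (y / a), y < a] ([eye]),
    which is star-shaped about the origin ([bounds_rim_eye]).

    Running through a rim at the speed of the flow is a scalar autonomous
    equation for the parameter of the direction.  Such an equation is solved for
    all times by separation of variables when the speed is positive and grows at
    most linearly ([scalar_flow]).  For [m < 1 / e] the parameter is the angle,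
    the speed is periodic, and the rim is a cycle ([cycle_rim]).  For
    [m = 1 / e] the direction [(0, 1)] is that of the stagnation point; the other
    directions are parametrized by the stereographic projection.  As
    [(1 - Y) ^ 2] is bounded by a multiple of [1 - s] ([lambert_holder]), the
    flow slows down linearly near the stagnation point, so that reaching it takes
    infinite time and the rest of the rim is one homoclinic streamline
    ([homoclinic_rim]).  The rims with [m < 1 / e] fill the eye of that loop.

    All the solutions so constructed are defined on the whole line, so they are
    maximal ([global_is_maximal]). *)

(** * Differentiation in the plane in terms of epsilon and delta *)

Lemma locally_C_disc (z : C) (V : C -> Prop) :
  locally z V <->
  exists e : R, 0 < e /\ forall w : C, Cmod (w - z) < e -> V w.
Proof.
rewrite locally_C; split.
- intros [e He]; exists (pos e); split; [apply cond_pos|].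
  intros w H; apply He; exact H.
- intros [e [e0 He]]; exists (mkposreal e e0).
  intros w H; apply He; exact H.
Qed.

Lemma Cmod_le_Rabs (z : C) : Cmod z <= Rabs (fst z) + Rabs (snd z).
Proof.
destruct z as [x y]; simpl.
replace ((x, y) : C) with (RtoC x + Ci * RtoC y)%C
  by (apply injective_projections; simpl; ring).
eapply Rle_trans; [apply Cmod_triangle|].
rewrite Cmod_mult, !Cmod_R, Cmod_Ci; lra.
Qed.

(** A neighbourhood filter converges to its centre only, so the quantification
    over the limits of the filter in [filterdiff] collapses. *)
Lemma filterdiff_iff_eps (K : AbsRing) (U V : NormedModule K)
  (f : U -> V) (x : U) (l : U -> V) : is_linear l ->
  filterdiff f (locally x) l <->
  forall e : R, 0 < e ->
    locally x (fun y => norm (minus (minus (f y) (f x)) (l (minus y x)))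
                        <= e * norm (minus y x)).
Proof.
intros Hl; split.
- intros [_ H] e e0; exact (H x (fun P HP => HP) (mkposreal e e0)).
- intros H; split; [exact Hl|]; intros y Hy e.
  rewrite <- (is_filter_lim_locally_unique _ _ Hy).
  exact (H e (cond_pos e)).
Qed.

Lemma is_derive_C_eps (f : C -> C) (z l : C) :
  @is_derive C_AbsRing C_NormedModule f z l <->
  forall e : R, 0 < e -> exists d : R, 0 < d /\
    forall w : C, Cmod (w - z) < d ->
      Cmod (f w - f z - (w - z) * l)%C <= e * Cmod (w - z).
Proof.
unfold is_derive.
rewrite (filterdiff_iff_eps C_AbsRing (AbsRing_NormedModule C_AbsRing)
  C_NormedModule); [|apply is_linear_scal_l].
split; intros H e e0.
- destruct (H e e0) as [d Hd]; exists (pos d); split; [apply cond_pos|].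
  intros w Hw; exact (Hd w Hw).
- destruct (H e e0) as [d [d0 Hd]]; exists (mkposreal d d0).
  intros w Hw; exact (Hd w Hw).
Qed.

Lemma is_derive_plane (g : R -> C) (t : R) (l : C) :
  @is_derive R_AbsRing C_R_NormedModule g t l <->
  is_derive (fun s => fst (g s)) t (fst l) /\
  is_derive (fun s => snd (g s)) t (snd l).
Proof.
split.
- intros H; split.
  + apply (filterdiff_comp' (U := AbsRing_NormedModule R_AbsRing)
      (V := C_R_NormedModule) (W := R_NormedModule) g fst t
      (fun y => scal y l) fst H).
    apply filterdiff_linear; apply is_linear_fst.
  + apply (filterdiff_comp' (U := AbsRing_NormedModule R_AbsRing)
      (V := C_R_NormedModule) (W := R_NormedModule) g snd t
      (fun y => scal y l) snd H).
    apply filterdiff_linear; apply is_linear_snd.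
- intros [H1 H2]; unfold is_derive in *.
  apply (filterdiff_iff_eps R_AbsRing (AbsRing_NormedModule R_AbsRing)
    C_R_NormedModule); [apply is_linear_scal_l|].
  intros e e0.
  assert (e2 : 0 < e / 2) by lra.
  destruct H1 as [_ H1]; destruct H2 as [_ H2].
  specialize (H1 t (fun P HP => HP) (mkposreal _ e2)).
  specialize (H2 t (fun P HP => HP) (mkposreal _ e2)).
  generalize (filter_and _ _ H1 H2); apply filter_imp.
  intros s [A B].
  change (Rabs (fst (g s) - fst (g t) - (s - t) * fst l)
          <= e / 2 * Rabs (s - t)) in A.
  change (Rabs (snd (g s) - snd (g t) - (s - t) * snd l)
          <= e / 2 * Rabs (s - t)) in B.
  set (p := (fst (g s) - fst (g t) - (s - t) * fst l,
             snd (g s) - snd (g t) - (s - t) * snd l) : C).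
  change (sqrt (Rabs (fst p) ^ 2 + Rabs (snd p) ^ 2) <= e * Rabs (s - t)).
  rewrite !pow2_abs; change (Cmod p <= e * Rabs (s - t)).
  assert (Hp := Cmod_le_Rabs p).
  unfold p in Hp at 2 3; simpl in Hp; lra.
Qed.

Lemma continuous_of_eps (f : R -> R) (x : R) :
  (forall e, 0 < e -> exists d, 0 < d /\
     forall y, Rabs (y - x) < d -> Rabs (f y - f x) < e) ->
  continuous f x.
Proof.
intros H; apply filterlim_locally; intros e.
destruct (H e (cond_pos e)) as [d [d0 Hd]].
exists (mkposreal d d0); intros y Hy; exact (Hd y Hy).
Qed.

Lemma eps_of_continuous (f : R -> R) (x : R) : continuous f x ->
  forall e, 0 < e -> exists d, 0 < d /\
     forall y, Rabs (y - x) < d -> Rabs (f y - f x) < e.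
Proof.
intros H e e0.
destruct (proj1 (filterlim_locally _ _) H (mkposreal e e0)) as [d Hd].
exists d; split; [apply cond_pos|]; intros y Hy; exact (Hd y Hy).
Qed.

(** The inverse function rule, for an inverse already known to be continuous:
    with [h = g y - g y0] the hypothesis reads [y - y0 = l h + o(h)], and the
    continuity of [g] makes the error small as [y] tends to [y0]. *)
Lemma is_derive_inverse (f g : R -> R) (y0 l : R) :
  is_derive f (g y0) l -> l <> 0 -> continuous g y0 ->
  locally y0 (fun y => f (g y) = y) ->
  is_derive g y0 (/ l).
Proof.
intros Hf Hl Hg Hfg.
apply is_derive_Reals; apply is_derive_Reals in Hf.
assert (E0 : f (g y0) = y0) by (exact (locally_singleton _ _ Hfg)).
destruct Hfg as [d1 Hfg].
assert (l0 : 0 < Rabs l) by (apply Rabs_pos_lt; exact Hl).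
intros e e0.
set (e' := Rmin (Rabs l / 2) (e * (Rabs l * Rabs l) / 4)).
assert (e'0 : 0 < e').
{ apply Rmin_pos; [lra|].
  assert (0 < Rabs l * Rabs l) by nra.
  assert (0 < e * (Rabs l * Rabs l)) by nra. lra. }
destruct (Hf e' e'0) as [d2 Hd2].
destruct (eps_of_continuous _ _ Hg d2 (cond_pos d2)) as [d3 [d30 Hd3]].
assert (d0 : 0 < Rmin d1 d3) by (apply Rmin_pos; [apply cond_pos|exact d30]).
exists (mkposreal _ d0); intros h h0 Hh; simpl in Hh.
assert (Hh1 : Rabs h < d1) by (eapply Rlt_le_trans; [exact Hh|apply Rmin_l]).
assert (Hh3 : Rabs h < d3) by (eapply Rlt_le_trans; [exact Hh|apply Rmin_r]).
assert (E : f (g (y0 + h)) = y0 + h).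
{ apply Hfg. change (Rabs (y0 + h - y0) < d1).
  replace (y0 + h - y0) with h by ring; exact Hh1. }
set (k := g (y0 + h) - g y0).
assert (k0 : k <> 0).
{ intros k0; apply h0.
  replace (g (y0 + h)) with (g y0) in E by (unfold k in k0; lra). lra. }
assert (Hk : Rabs k < d2).
{ apply Hd3. replace (y0 + h - y0) with h by ring; exact Hh3. }
specialize (Hd2 k k0 Hk).
replace (g y0 + k) with (g (y0 + h)) in Hd2 by (unfold k; ring).
rewrite E, E0 in Hd2.
replace (y0 + h - y0) with h in Hd2 by ring.
assert (ak : 0 < Rabs k) by (apply Rabs_pos_lt; exact k0).
assert (ah : 0 < Rabs h) by (apply Rabs_pos_lt; exact h0).
assert (H1 : Rabs (h - l * k) < e' * Rabs k).
{ replace (h - l * k) with ((h / k - l) * k) by (field; exact k0).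
  rewrite Rabs_mult. apply Rmult_lt_compat_r; assumption. }
assert (H2 : Rabs l * Rabs k <= 2 * Rabs h).
{ rewrite <- Rabs_mult.
  assert (Rabs (l * k) <= Rabs h + Rabs (h - l * k)).
  { replace (l * k) with (h - (h - l * k)) at 1 by ring.
    eapply Rle_trans; [apply Rabs_triang|]. rewrite Rabs_Ropp; lra. }
  assert (e' <= Rabs l / 2) by apply Rmin_l.
  assert (e' * Rabs k <= Rabs l / 2 * Rabs k) by
    (apply Rmult_le_compat_r; lra).
  rewrite Rabs_mult in *. lra. }
fold k.
replace (k / h - / l) with (- (h - l * k) / (h * l)) by (field; auto).
unfold Rdiv; rewrite Rabs_mult, Rabs_Ropp, Rabs_inv, Rabs_mult.
assert (0 < Rabs h * Rabs l) by nra.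
apply Rmult_lt_reg_r with (Rabs h * Rabs l); [assumption|].
rewrite Rmult_assoc, Rinv_l, Rmult_1_r; [|lra].
eapply Rlt_le_trans; [exact H1|].
assert (e' <= e * (Rabs l * Rabs l) / 4) by apply Rmin_r.
apply Rle_trans with (e * (Rabs l * Rabs l) / 4 * Rabs k).
{ apply Rmult_le_compat_r; lra. }
replace (e * (Rabs l * Rabs l) / 4 * Rabs k)
  with (e * Rabs l / 4 * (Rabs l * Rabs k)) by field.
apply Rle_trans with (e * Rabs l / 4 * (2 * Rabs h)).
- apply Rmult_le_compat_l; [|exact H2]. assert (0 < e * Rabs l) by nra; lra.
- assert (0 < e * (Rabs h * Rabs l)) by nra. nra.
Qed.

(** * Branches of the logarithm *)

Lemma is_derive_R_eps (f : R -> R) (x l : R) : is_derive f x l ->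
  forall e, 0 < e -> exists d, 0 < d /\
    forall y, Rabs (y - x) < d ->
      Rabs (f y - f x - (y - x) * l) <= e * Rabs (y - x).
Proof.
intros [_ H] e e0.
destruct (H x (fun P HP => HP) (mkposreal e e0)) as [d Hd].
exists d; split; [apply cond_pos|]; intros y Hy; exact (Hd y Hy).
Qed.

Lemma Cexp_plus (z w : C) : Cexp (z + w)%C = (Cexp z * Cexp w)%C.
Proof.
destruct z as [a b], w as [c d]; unfold Cexp, Re, Im; simpl.
rewrite exp_plus, cos_plus, sin_plus.
apply injective_projections; simpl; ring.
Qed.

Lemma Cmod_Cexp (z : C) : Cmod (Cexp z) = exp (Re z).
Proof.
unfold Cexp, Cmod; simpl.
replace (_ + _) with (exp (Re z) * exp (Re z)).
- apply sqrt_square; left; apply exp_pos.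
- generalize (sin2_cos2 (Im z)); unfold Rsqr; intros H.
  transitivity (exp (Re z) * exp (Re z)
    * (sin (Im z) * sin (Im z) + cos (Im z) * cos (Im z))); [rewrite H|]; ring.
Qed.

(** With [h = a + i b], the real part of the error is
    [(exp a - 1 - a) cos b + (1 + a) (cos b - 1)] and its imaginary part is
    [(exp a - 1) sin b + (sin b - b)]; every term is small compared to [h]. *)
Lemma Cexp_at_0 (e : R) : 0 < e -> exists d, 0 < d /\
  forall h : C, Cmod h < d -> Cmod (Cexp h - 1 - h)%C <= e * Cmod h.
Proof.
intros e0.
set (e' := Rmin 1 (e / 8)).
assert (e'0 : 0 < e') by (apply Rmin_pos; lra).
assert (E1 : is_derive exp 0 1) by (auto_derive; [trivial|rewrite exp_0; ring]).
assert (E2 : is_derive cos 0 0) by (auto_derive; [trivial|rewrite sin_0; ring]).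
assert (E3 : is_derive sin 0 1) by (auto_derive; [trivial|rewrite cos_0; ring]).
destruct (is_derive_R_eps _ _ _ E1 _ e'0) as [d1 [d10 H1]].
destruct (is_derive_R_eps _ _ _ E2 _ e'0) as [d2 [d20 H2]].
destruct (is_derive_R_eps _ _ _ E3 _ e'0) as [d3 [d30 H3]].
exists (Rmin (Rmin d1 d2) (Rmin d3 e')); split.
{ apply Rmin_pos; apply Rmin_pos; assumption. }
intros [a b] Hh.
generalize (Rmax_Cmod (a, b)); simpl; intros Hm.
assert (Ha : Rabs a <= Cmod (a, b)) by (eapply Rle_trans; [apply Rmax_l|exact Hm]).
assert (Hb : Rabs b <= Cmod (a, b)) by (eapply Rle_trans; [apply Rmax_r|exact Hm]).
generalize (Rmin_l (Rmin d1 d2) (Rmin d3 e')) (Rmin_r (Rmin d1 d2) (Rmin d3 e'))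
  (Rmin_l d1 d2) (Rmin_r d1 d2) (Rmin_l d3 e') (Rmin_r d3 e'); intros.
assert (L1 : e' <= 1) by apply Rmin_l.
assert (L2 : e' <= e / 8) by apply Rmin_r.
specialize (H1 a ltac:(rewrite Rminus_0_r; lra)).
specialize (H2 b ltac:(rewrite Rminus_0_r; lra)).
specialize (H3 b ltac:(rewrite Rminus_0_r; lra)).
rewrite !Rminus_0_r in *.
rewrite exp_0 in H1; rewrite cos_0 in H2; rewrite sin_0 in H3.
rewrite Rmult_0_r, Rminus_0_r in H2; rewrite Rmult_1_r in *.
rewrite Rminus_0_r in H3.
set (n := Cmod (a, b)) in *.
eapply Rle_trans; [apply Cmod_le_Rabs|].
unfold Cexp, Re, Im; simpl.
replace (exp a * cos b + - (1) + - a)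
  with ((exp a - 1 - a) * cos b + (1 + a) * (cos b - 1)) by ring.
replace (exp a * sin b + - 0 + - b)
  with ((exp a - 1) * sin b + (sin b - b)) by ring.
assert (Pa := Rabs_pos a); assert (Pb := Rabs_pos b).
assert (A1 : Rabs ((exp a - 1 - a) * cos b) <= e' * Rabs a).
{ rewrite Rabs_mult.
  assert (Rabs (cos b) <= 1) by (apply Rabs_le; apply COS_bound).
  assert (T := Rabs_pos (exp a - 1 - a)); assert (T' := Rabs_pos (cos b)). nra. }
assert (A2 : Rabs ((1 + a) * (cos b - 1)) <= 2 * (e' * Rabs b)).
{ rewrite Rabs_mult.
  assert (Rabs (1 + a) <= 2).
  { eapply Rle_trans; [apply Rabs_triang|]; rewrite Rabs_R1; lra. }
  assert (T := Rabs_pos (1 + a)); assert (T' := Rabs_pos (cos b - 1)). nra. }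
assert (A3 : Rabs ((exp a - 1) * sin b) <= e' * (4 * Rabs b)).
{ rewrite Rabs_mult.
  assert (B1 : Rabs (exp a - 1) <= 2 * e').
  { replace (exp a - 1) with ((exp a - 1 - a) + a) by ring.
    eapply Rle_trans; [apply Rabs_triang|]. nra. }
  assert (B2 : Rabs (sin b) <= 2 * Rabs b).
  { replace (sin b) with ((sin b - b) + b) by ring.
    eapply Rle_trans; [apply Rabs_triang|]. nra. }
  assert (T := Rabs_pos (exp a - 1)); assert (T' := Rabs_pos (sin b)). nra. }
assert (A4 := Rabs_triang ((exp a - 1 - a) * cos b) ((1 + a) * (cos b - 1))).
assert (A5 := Rabs_triang ((exp a - 1) * sin b) (sin b - b)).
assert (e' * Rabs a <= e / 8 * n) by nra.
assert (e' * Rabs b <= e / 8 * n) by nra.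
lra.
Qed.

Lemma Cexp_neq_0 (z : C) : Cexp z <> RtoC 0.
Proof.
intros E; generalize (Cmod_Cexp z); rewrite E, Cmod_0.
generalize (exp_pos (Re z)); lra.
Qed.

(** A continuous branch of the logarithm is differentiable because its inverse
    is: [Cexp (lg z + h) = z * Cexp h] differs from [z] by [z h + o(h)]. *)
Lemma is_derive_log_branch (U : C -> Prop) (lg : C -> C) (z : C) :
  log_branch U lg -> U z -> @is_derive C_AbsRing C_NormedModule lg z (/ z)%C.
Proof.
intros [HU [_ [Hc HE]]] Hz.
assert (z0 : z <> RtoC 0) by (rewrite <- (HE z Hz); apply Cexp_neq_0).
assert (m0 : 0 < Cmod z) by (apply Cmod_gt_0; exact z0).
apply is_derive_C_eps; intros e e0.
set (m := Cmod z) in *.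
set (e' := Rmin (1 / 2) (e * m / 2)).
assert (e'0 : 0 < e').
{ apply Rmin_pos; [lra|]. assert (0 < e * m) by nra; lra. }
destruct (Cexp_at_0 e' e'0) as [d1 [d10 H1]].
assert (HV : locally z (fun w => U w /\ Cmod (lg w - lg z)%C < d1)).
{ apply filter_and; [apply HU; exact Hz|].
  assert (Hn : locally (lg z) (fun u => Cmod (u - lg z)%C < d1)).
  { apply locally_C_disc; exists d1; auto. }
  specialize (Hc z Hz _ Hn).
  unfold filtermap, within in Hc.
  generalize (filter_and _ _ Hc (HU z Hz)); apply filter_imp; tauto. }
apply locally_C_disc in HV; destruct HV as [d [d0 Hd]].
exists d; split; [exact d0|]; intros w Hw.
destruct (Hd w Hw) as [Uw Hw1].
set (h := (lg w - lg z)%C) in *.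
specialize (H1 h Hw1).
assert (Ew : w = (z * Cexp h)%C).
{ rewrite <- (HE z Hz) at 1; rewrite <- Cexp_plus.
  replace (lg z + h)%C with (lg w) by (unfold h; ring).
  symmetry; apply HE; exact Uw. }
set (r := (Cexp h - 1 - h)%C) in *.
assert (Er : (w - z = z * h + z * r)%C) by (rewrite Ew; unfold r; ring).
replace (h - (w - z) * / z)%C with (- r)%C
  by (rewrite Er; field; exact z0).
rewrite Cmod_opp.
assert (L1 : e' <= 1 / 2) by apply Rmin_l.
assert (L2 : e' <= e * m / 2) by apply Rmin_r.
assert (Ph := Cmod_ge_0 h).
assert (Hh : m * Cmod h <= 2 * Cmod (w - z)%C).
{ assert (T : m * Cmod h <= Cmod (w - z)%C + m * Cmod r).
  { unfold m; rewrite <- !Cmod_mult, <- (Cmod_opp (z * r)).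
    assert (Eh : (z * h = (w - z) + - (z * r))%C) by (rewrite Er; ring).
    rewrite Eh at 1.
    apply Cmod_triangle. }
  assert (Cmod r <= Cmod h / 2) by nra.
  assert (m * Cmod r <= m * (Cmod h / 2)) by (apply Rmult_le_compat_l; lra).
  lra. }
assert (Cmod r <= e * m / 2 * Cmod h) by nra.
assert (e / 2 * (m * Cmod h) <= e / 2 * (2 * Cmod (w - z)%C))
  by (apply Rmult_le_compat_l; lra).
lra.
Qed.

Lemma Re_log_branch (U : C -> Prop) (lg : C -> C) (z : C) :
  log_branch U lg -> U z -> Re (lg z) = ln (Cmod z).
Proof.
intros [_ [_ [_ HE]]] Hz.
rewrite <- (HE z Hz) at 2; rewrite Cmod_Cexp, ln_exp; reflexivity.
Qed.

Lemma is_derive_C_unique (f : C -> C) (z l l' : C) :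
  @is_derive C_AbsRing C_NormedModule f z l ->
  @is_derive C_AbsRing C_NormedModule f z l' -> l = l'.
Proof.
intros H H'; rewrite is_derive_C_eps in H, H'.
apply NNPP; intros N.
assert (n0 : 0 < Cmod (l - l')%C).
{ apply Cmod_gt_0; intros E; apply N.
  replace l with ((l - l') + l')%C by ring; rewrite E; ring. }
set (n := Cmod (l - l')%C) in *.
destruct (H (n / 4) ltac:(lra)) as [d [d0 Hd]].
destruct (H' (n / 4) ltac:(lra)) as [d' [d'0 Hd']].
assert (p0 : 0 < Rmin d d') by (apply Rmin_pos; assumption).
set (s := Rmin d d' / 2).
assert (s0 : 0 < s) by (unfold s; lra).
assert (Es : Cmod ((z + RtoC s) - z)%C = s).
{ replace ((z + RtoC s) - z)%C with (RtoC s) by ring.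
  rewrite Cmod_R; apply Rabs_pos_eq; lra. }
assert (Rmin d d' <= d) by apply Rmin_l.
assert (Rmin d d' <= d') by apply Rmin_r.
specialize (Hd (z + RtoC s)%C ltac:(rewrite Es; unfold s; lra)).
specialize (Hd' (z + RtoC s)%C ltac:(rewrite Es; unfold s; lra)).
rewrite Es in Hd, Hd'.
set (u := (f (z + RtoC s) - f z)%C) in *.
assert (T : s * n <= n / 4 * s + n / 4 * s).
{ assert (s * n = Cmod ((u - ((z + RtoC s) - z) * l')
      + - (u - ((z + RtoC s) - z) * l))%C) as ->.
  - replace (_ + _)%C with (RtoC s * (l - l'))%C by ring.
    rewrite Cmod_mult, Cmod_R, Rabs_pos_eq by lra; reflexivity.
  - eapply Rle_trans; [apply Cmod_triangle|]. rewrite Cmod_opp; lra. }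
nra.
Qed.

(** * The field, its potential and its stagnation point *)

Lemma is_derive_C_affine_comb (f : C -> C) (A B z l : C) :
  @is_derive C_AbsRing C_NormedModule f z l ->
  @is_derive C_AbsRing C_NormedModule
    (fun w => A * w + B * f w)%C z (A + B * l)%C.
Proof.
intros H; rewrite is_derive_C_eps in *; intros e e0.
assert (B0 := Cmod_ge_0 B).
assert (e'0 : 0 < e / (Cmod B + 1)) by (apply Rdiv_lt_0_compat; lra).
destruct (H _ e'0) as [d [d0 Hd]]; exists d; split; [exact d0|].
intros w Hw; specialize (Hd w Hw).
replace (A * w + B * f w - (A * z + B * f z) - (w - z) * (A + B * l))%C
  with (B * (f w - f z - (w - z) * l))%C by ring.
rewrite Cmod_mult.
assert (W := Cmod_ge_0 (w - z)%C).
apply Rle_trans with (Cmod B * (e / (Cmod B + 1) * Cmod (w - z)%C)).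
{ apply Rmult_le_compat_l; assumption. }
replace (Cmod B * (e / (Cmod B + 1) * Cmod (w - z)%C))
  with (Cmod B / (Cmod B + 1) * (e * Cmod (w - z)%C)) by (field; lra).
rewrite <- (Rmult_1_l (e * Cmod (w - z)%C)) at 2.
apply Rmult_le_compat_r; [nra|].
apply Rmult_le_reg_r with (Cmod B + 1); [lra|].
field_simplify; lra.
Qed.

Lemma norm2_pos (z : C) : z <> RtoC 0 -> 0 < fst z ^ 2 + snd z ^ 2.
Proof.
intros H; apply Cmod_gt_0 in H; unfold Cmod in H.
apply sqrt_lt_0_alt; rewrite sqrt_0; exact H.
Qed.

Lemma norm2_neq_0 (x y : R) : 0 < x ^ 2 + y ^ 2 -> ((x, y) : C) <> RtoC 0.
Proof. intros H E; injection E as -> ->; lra. Qed.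

(** [current] with [kap = hbar k / M] and [a = delta / k], the only two
    combinations of the constants on which it depends. *)
Definition vortex_flow (kap a : R) (p : C) : C :=
  (kap * (- 1 + a * (snd p / (fst p ^ 2 + snd p ^ 2))),
   kap * (- a * (fst p / (fst p ^ 2 + snd p ^ 2)))).

Lemma vortex_flow_conj (kap a : R) (z : C) : z <> RtoC 0 ->
  ((fst (vortex_flow kap a z), - snd (vortex_flow kap a z)) : C)
  = (RtoC kap * (- (1) + Ci * RtoC a * / z))%C.
Proof.
intros H; apply norm2_pos in H; destruct z as [x y]; simpl in H.
apply injective_projections; simpl; field; simpl; lra.
Qed.

Lemma potential_derive (hbar M k delta : R) (U : C -> Prop) (lg : C -> C) (z : C) :
  log_branch U lg -> U z ->
  z <> RtoC 0 /\
  @is_derive C_AbsRing C_NormedModule (potential hbar M k delta lg) z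
    (fst (current hbar M k delta z), - snd (current hbar M k delta z)).
Proof.
intros Hlg Hz.
assert (z0 : z <> RtoC 0).
{ destruct Hlg as [_ [_ [_ HE]]]; rewrite <- (HE z Hz); apply Cexp_neq_0. }
split; [exact z0|].
assert (E := vortex_flow_conj (hbar * k / M) (delta / k) z z0).
change (vortex_flow _ _ _) with (current hbar M k delta z) in E.
rewrite E.
assert (H := is_derive_C_affine_comb lg (- RtoC (hbar * k / M))%C
  (RtoC (hbar * k / M) * Ci * RtoC (delta / k))%C z _ (is_derive_log_branch U lg z Hlg Hz)).
replace (RtoC (hbar * k / M) * (- (1) + Ci * RtoC (delta / k) * / z))%C
  with (- RtoC (hbar * k / M) + RtoC (hbar * k / M) * Ci * RtoC (delta / k) * / z)%C
  by (field; exact z0).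
eapply is_derive_ext; [|exact H].
intros w; unfold potential; simpl; ring.
Qed.

Lemma stagnation_iff (kap a : R) (z : C) : 0 < kap -> 0 < a ->
  (z <> RtoC 0 /\ vortex_flow kap a z = RtoC 0) <-> z = (0, a).
Proof.
intros k0 a0; split.
- intros [H E]; apply norm2_pos in H; destruct z as [x y]; simpl in H.
  injection E as E1 E2; simpl in E1, E2.
  assert (x0 : x = 0).
  { assert (E3 : kap * a * (x / (x * (x * 1) + y * (y * 1))) = 0) by lra.
    apply Rmult_integral in E3; destruct E3 as [E3|E3]; [nra|].
    apply Rmult_integral in E3; destruct E3 as [E3|E3]; [exact E3|].
    contradict E3; apply Rinv_neq_0_compat; lra. }
  subst x.
  assert (y0 : y <> 0) by (intros ->; lra).
  assert (E3 : - 1 + a * (y / (0 * (0 * 1) + y * (y * 1))) = 0).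
  { apply Rmult_integral in E1; destruct E1; [lra|assumption]. }
  f_equal; replace (a * _) with (a / y) in E3 by (field; exact y0).
  replace y with (a / (a / y)) by (field; lra).
  replace (a / y) with 1 by lra; field.
- intros ->; split; [apply norm2_neq_0; nra|].
  unfold vortex_flow; simpl; apply injective_projections; simpl; field; lra.
Qed.

(** The linear part at [(0, a)] sends [(x, y)] to [- (kap / a) (y, x)], hence
    contracts the diagonal and expands the antidiagonal. *)
Lemma saddle_vortex_flow (kap a : R) (D : C -> Prop) : 0 < kap -> 0 < a ->
  D (0, a) -> saddle D (vortex_flow kap a) (0, a).
Proof.
intros k0 a0 HD; split; [split; [exact HD|]|].
{ apply (proj2 (stagnation_iff kap a (0, a) k0 a0) eq_refl). }
set (A := fun v : C => (- (kap / a) * snd v, - (kap / a) * fst v) : C).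
assert (q0 : 0 < kap / a) by (apply Rdiv_lt_0_compat; assumption).
assert (HA : forall v : C, Cmod (A v) = kap / a * Cmod v).
{ intros v.
  transitivity (Cmod (RtoC (- (kap / a)) * (snd v, fst v))%C).
  - f_equal; apply injective_projections; simpl; ring.
  - rewrite Cmod_mult, Cmod_R, Rabs_Ropp, (Rabs_pos_eq (kap / a)) by lra.
    f_equal; unfold Cmod; simpl; f_equal; ring. }
exists A; split.
- assert (lin : @is_linear R_AbsRing C_R_NormedModule C_R_NormedModule A).
  { split.
    - intros x y; apply injective_projections; simpl; unfold plus; simpl; ring.
    - intros t x; apply injective_projections; simpl;
        unfold scal; simpl; unfold mult; simpl; ring.
    - exists (kap / a); split; [exact q0|]; intros v.
      rewrite <- !Cmod_norm; rewrite HA; lra. }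
  apply (filterdiff_iff_eps R_AbsRing C_R_NormedModule C_R_NormedModule);
    [exact lin|]; intros e e0.
  apply (proj2 (locally_C_disc (0, a) _)).
  (* [F'(z) - F'(z0) - F''(z0) (z - z0) = i kap a (z - z0)^2 / (z z0^2)], and
     the field is the conjugate of [F']. *)
  exists (Rmin (a / 2) (e * (a * a) / (2 * kap))); split.
  { apply Rmin_pos; [lra|]. apply Rdiv_lt_0_compat; [|lra].
    assert (0 < a * a) by nra. nra. }
  intros w Hw.
  assert (W1 : Cmod (w - (0, a))%C <= a / 2)
    by (left; eapply Rlt_le_trans; [exact Hw|apply Rmin_l]).
  assert (W2 : Cmod (w - (0, a))%C <= e * (a * a) / (2 * kap))
    by (left; eapply Rlt_le_trans; [exact Hw|apply Rmin_r]).
  assert (Ca : Cmod (0, a) = a).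
  { unfold Cmod; simpl; replace (_ + _) with (a * a) by ring.
    apply sqrt_square; lra. }
  assert (W3 : a / 2 <= Cmod w).
  { assert (T := Cmod_triangle (w) (- (w - (0, a)))%C).
    replace (w + - (w - (0, a)))%C with (0, a) in T
      by (apply injective_projections; simpl; ring).
    rewrite Cmod_opp, Ca in T; lra. }
  assert (w0 : w <> RtoC 0) by (apply Cmod_gt_0; lra).
  set (h := (w - (0, a))%C) in *.
  set (r := minus (minus (vortex_flow kap a w) (vortex_flow kap a (0, a)))
              (A (minus w ((0, a) : C))) : C).
  change (@norm R_AbsRing C_R_NormedModule r
          <= e * @norm R_AbsRing C_R_NormedModule h).
  rewrite <- !Cmod_norm.
  assert (z00 : ((0, a) : C) <> RtoC 0) by (apply Cmod_gt_0; lra).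
  assert (Er : Cconj r
      = (RtoC (kap * a) * Ci * (h * h) / (w * ((0, a) * (0, a))))%C).
  { assert (E1 : Cconj r = (RtoC kap * (- (1) + Ci * RtoC a * / w)
        - RtoC kap * (- (1) + Ci * RtoC a * / (0, a))
        - RtoC (kap / a) * Ci * h)%C).
    { rewrite <- !vortex_flow_conj by assumption.
      unfold r, h, A; generalize (vortex_flow kap a w) (vortex_flow kap a (0, a)).
      intros p q; apply injective_projections; simpl;
        unfold minus, plus, opp; simpl; unfold plus, opp; simpl; ring. }
    assert (E2 : (RtoC (kap / a) * Ci
        = - (RtoC (kap * a) * Ci / ((0, a) * (0, a))))%C).
    { apply injective_projections; simpl; field; nra. }
    rewrite E1, E2, RtoC_mult; unfold h; field; auto. }
  rewrite <- Cmod_conj, Er.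
  unfold Cdiv; rewrite !Cmod_mult, Cmod_inv, !Cmod_mult, Ca, Cmod_R, Cmod_Ci
    by (repeat apply Cmult_neq_0; assumption).
  rewrite Rabs_pos_eq by nra.
  set (n := Cmod h) in *; set (l := Cmod w) in *.
  assert (n0 : 0 <= n) by apply Cmod_ge_0.
  apply Rmult_le_reg_r with (l * a); [nra|].
  replace (kap * a * 1 * (n * n) * / (l * (a * a)) * (l * a))
    with (kap * n * n) by (field; lra).
  assert (T : kap * n <= e * (a * a) / 2).
  { apply (Rmult_le_compat_l kap) in W2; [|lra].
    replace (kap * (e * (a * a) / (2 * kap))) with (e * (a * a) / 2) in W2
      by (field; lra). exact W2. }
  apply Rle_trans with (e * (a * a) / 2 * n);
    [apply Rmult_le_compat_r; assumption|].
  replace (e * (a * a) / 2 * n) with (e * n * (a / 2 * a)) by field.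
  apply Rmult_le_compat_l; [nra|]. apply Rmult_le_compat_r; lra.
- exists (- (kap / a)), (kap / a), (1, 1), (1, - 1).
  split; [lra|].
  split; [intros E; injection E; lra|].
  split; [intros E; injection E; lra|].
  split; apply injective_projections; simpl; field; lra.
Qed.

(** * Solutions on intervals *)

Lemma constant_of_derive_0 (a b : Rbar) (g : R -> R) :
  (forall t : R, Rbar_lt a t -> Rbar_lt t b -> is_derive g t 0) ->
  forall s t : R, Rbar_lt a s -> Rbar_lt s b -> Rbar_lt a t -> Rbar_lt t b ->
    g s = g t.
Proof.
intros H.
assert (L : forall s t : R, Rbar_lt a s -> Rbar_lt t b -> s < t -> g s = g t).
{ intros s t Hs Ht st; apply (eq_is_derive g s t); [|exact st].
  intros r [r1 r2]; apply H.
  - apply (Rbar_lt_le_trans a s r); [exact Hs|exact r1].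
  - apply (Rbar_le_lt_trans r t b); [exact r2|exact Ht]. }
intros s t Hs1 Hs2 Ht1 Ht2.
destruct (Rtotal_order s t) as [l|[e|l]].
- apply L; assumption.
- now rewrite e.
- symmetry; apply L; assumption.
Qed.

Lemma Rbar_lt_between (a b : Rbar) : Rbar_lt a b ->
  exists t : R, Rbar_lt a t /\ Rbar_lt t b.
Proof.
destruct a as [a| |], b as [b| |]; simpl; intros H; try contradiction.
- exists ((a + b) / 2); lra.
- exists (a + 1); lra.
- exists (b - 1); lra.
- exists 0; auto.
Qed.

Lemma global_is_maximal (D : C -> Prop) (q : C -> C) (g : R -> C) :
  (forall t, D (g t) /\ @is_derive R_AbsRing C_R_NormedModule g t (q (g t))) ->
  maximal_integral_curve D q m_infty p_infty g.
Proof.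
intros H; split; [split; [exact I|auto]|].
intros a' b' h Ha Hb _ _.
destruct a'; try contradiction; destruct b'; try contradiction; auto.
Qed.

(** * Parallel flow *)

(** A solution of [g' = (c, 0)] coincides with an affine one, which extends to
    the whole line; so a maximal solution sweeps a whole horizontal line. *)
Lemma streamline_constant_field (D : C -> Prop) (q : C -> C) (c : R) :
  c <> 0 -> (forall p, D p) -> (forall p, q p = (c, 0)) ->
  forall S : C -> Prop,
    streamline D q S <-> exists y : R, forall p, S p <-> snd p = y.
Proof.
intros c0 HD Hq S.
assert (line : forall x y t0 t,
  @is_derive R_AbsRing C_R_NormedModule
    (fun s => (x + (s - t0) * c, y) : C) t (c, 0)).
{ intros x y t0 t; apply is_derive_plane; simpl; split; auto_derive; auto; ring. }
split.
- intros [a [b [g [[[Hab Hg] Hmax] HS]]]].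
  destruct (Rbar_lt_between a b Hab) as [t0 [Ha Hb]].
  set (h := fun t => (fst (g t0) + (t - t0) * c, snd (g t0)) : C).
  assert (Hgh : forall t : R, Rbar_lt a t -> Rbar_lt t b -> h t = g t).
  { assert (D1 : forall t : R, Rbar_lt a t -> Rbar_lt t b ->
      is_derive (fun s => fst (g s) - (s - t0) * c) t 0 /\
      is_derive (fun s => snd (g s)) t 0).
    { intros t H1 H2; destruct (Hg t H1 H2) as [_ H].
      rewrite Hq in H; apply is_derive_plane in H; destruct H as [E1 E2].
      split; [|exact E2]; simpl in E1.
      replace 0 with (c - c) by ring.
      apply (is_derive_minus (fun s => fst (g s)) (fun s => (s - t0) * c));
        [exact E1|auto_derive; auto; ring]. }
    intros t H1 H2; unfold h; apply injective_projections; simpl.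
    - assert (E := constant_of_derive_0 a b (fun s => fst (g s) - (s - t0) * c)
        (fun r A B => proj1 (D1 r A B)) t t0 H1 H2 Ha Hb).
      simpl in E; lra.
    - apply (constant_of_derive_0 a b (fun s => snd (g s))
        (fun r A B => proj2 (D1 r A B)) t0 t); assumption. }
  destruct (Hmax m_infty p_infty h) as [Ea Eb]; try exact Hgh.
  { exact I. }
  { destruct b; exact I. }
  { split; [exact I|]; intros t _ _; split; [apply HD|].
    rewrite Hq; apply line. }
  subst a b.
  exists (snd (g t0)); intros p; rewrite HS; split.
  + intros [t [_ [_ ->]]]; rewrite <- (Hgh t I I); reflexivity.
  + intros E; exists (t0 + (fst p - fst (g t0)) / c); repeat split.
    rewrite <- Hgh by exact I; unfold h.
    apply injective_projections; simpl; [field; exact c0|exact E].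
- intros [y Hy].
  exists m_infty, p_infty, (fun t => (0 + (t - 0) * c, y) : C); split.
  + apply global_is_maximal; intros t; split; [apply HD|].
    rewrite Hq; apply line.
  + intros p; rewrite Hy; split.
    * intros E; exists (fst p / c); repeat split.
      apply injective_projections; simpl; [field; exact c0|exact E].
    * intros [t [_ [_ ->]]]; reflexivity.
Qed.

(** * First integral and symmetry *)

(** [stream_function] in the constants [kap] and [a]. *)
Definition stream (kap a : R) (p : C) : R :=
  kap * (- snd p + a * ln (sqrt (fst p ^ 2 + snd p ^ 2))).

Lemma stream_constant (kap a : R) (D : C -> Prop) (s t : Rbar) (g : R -> C) :
  (forall p, D p -> p <> RtoC 0) ->
  integral_curve D (vortex_flow kap a) s t g ->
  forall r r' : R, Rbar_lt s r -> Rbar_lt r t -> Rbar_lt s r' -> Rbar_lt r' t ->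
    stream kap a (g r) = stream kap a (g r').
Proof.
intros HD [_ Hg].
apply (constant_of_derive_0 s t (fun r => stream kap a (g r))).
intros r H1 H2; destruct (Hg r H1 H2) as [Dr E]; unfold stream.
apply HD, norm2_pos in Dr; apply is_derive_plane in E; destruct E as [E1 E2].
set (X := fun r => fst (g r)); set (Y := fun r => snd (g r)).
change (is_derive X r (fst (vortex_flow kap a (g r)))) in E1.
change (is_derive Y r (snd (vortex_flow kap a (g r)))) in E2.
assert (n0 : 0 < X r * (X r * 1) + Y r * (Y r * 1)) by (unfold X, Y; simpl in Dr; lra).
assert (H : is_derive (fun r => kap * (- Y r + a * ln (sqrt (X r ^ 2 + Y r ^ 2)))) r
  (kap * (- snd (vortex_flow kap a (g r)) + a *
     ((X r * fst (vortex_flow kap a (g r)) + Y r * snd (vortex_flow kap a (g r)))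
      / (X r ^ 2 + Y r ^ 2))))).
{ auto_derive.
  - repeat split; try (eexists; eassumption); try exact n0.
    apply sqrt_lt_R0; exact n0.
  - change (Derive (fun x : R => X x) r) with (Derive X r).
    change (Derive (fun x : R => Y x) r) with (Derive Y r).
    rewrite (is_derive_unique X _ _ E1), (is_derive_unique Y _ _ E2).
    assert (n1 := sqrt_lt_R0 _ n0); assert (n2 := sqrt_sqrt _ (Rlt_le _ _ n0)).
    set (n := sqrt _) in *.
    replace (X r ^ 2 + Y r ^ 2) with (n * n) by (simpl; exact n2).
    field; lra. }
replace 0 with (kap * (- snd (vortex_flow kap a (g r)) + a *
     ((X r * fst (vortex_flow kap a (g r)) + Y r * snd (vortex_flow kap a (g r)))
      / (X r ^ 2 + Y r ^ 2)))); [exact H|].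
unfold vortex_flow, X, Y in *; simpl in *; field; lra.
Qed.

(** The first component of the field is even in [x] and the second one odd, so
    [t |-> (- x (- t), y (- t))] is a solution whenever [(x, y)] is. *)
Lemma streamline_reflect (kap a : R) (D : C -> Prop) (S : C -> Prop) :
  (forall p : C, D p -> D (- fst p, snd p)) ->
  streamline D (vortex_flow kap a) S ->
  streamline D (vortex_flow kap a) (fun p => S (- fst p, snd p)).
Proof.
intros HD.
assert (opp1 : forall (b : Rbar) (t : R), Rbar_lt (Rbar_opp b) t <-> Rbar_lt (- t) b)
  by (intros [b| |] t; simpl; try tauto; split; intros; lra).
assert (opp2 : forall (b : Rbar) (t : R), Rbar_lt t (Rbar_opp b) <-> Rbar_lt b (- t))
  by (intros [b| |] t; simpl; try tauto; split; intros; lra).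
assert (curve : forall a1 b1 g, integral_curve D (vortex_flow kap a) a1 b1 g ->
  integral_curve D (vortex_flow kap a) (Rbar_opp b1) (Rbar_opp a1)
    (fun t => (- fst (g (- t)), snd (g (- t))))).
{ intros a1 b1 g [Hab Hg]; split; [apply Rbar_opp_lt; exact Hab|].
  intros t H1 H2; apply opp1 in H1; apply opp2 in H2.
  destruct (Hg _ H2 H1) as [E1 E2]; split; [apply HD; exact E1|].
  apply is_derive_plane in E2; destruct E2 as [E2 E3].
  apply is_derive_plane; unfold vortex_flow in *; simpl in *; split.
  - replace (- fst (g (- t)) * (- fst (g (- t)) * 1))
      with (fst (g (- t)) * (fst (g (- t)) * 1)) by ring.
    set (l := kap * _) in *; replace l with (- (- 1 * l)) by ring.
    apply (is_derive_opp (fun s => fst (g (- s)))).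
    apply (is_derive_comp (fun s => fst (g s)) Ropp); [exact E2|].
    auto_derive; auto.
  - replace (- fst (g (- t)) * (- fst (g (- t)) * 1))
      with (fst (g (- t)) * (fst (g (- t)) * 1)) by ring.
    set (l := kap * _) in E3.
    replace (kap * _) with (- 1 * l).
    + apply (is_derive_comp (fun s => snd (g s)) Ropp); [exact E3|].
      auto_derive; auto.
    + unfold l, Rdiv; ring. }
intros [a1 [b1 [g [[Hg Hmax] HS]]]].
exists (Rbar_opp b1), (Rbar_opp a1), (fun t => (- fst (g (- t)), snd (g (- t)))).
split; [split; [apply curve; exact Hg|]|].
- intros a' b' h Ha Hb Hh Hgh.
  destruct (Hmax (Rbar_opp b') (Rbar_opp a')
    (fun t => (- fst (h (- t)), snd (h (- t))))) as [E1 E2].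
  + rewrite <- (Rbar_opp_involutive a1); apply Rbar_opp_le; exact Hb.
  + rewrite <- (Rbar_opp_involutive b1); apply Rbar_opp_le; exact Ha.
  + apply curve; exact Hh.
  + intros t H1 H2; rewrite Hgh; simpl.
    * rewrite !Ropp_involutive; destruct (g t); reflexivity.
    * apply opp1; rewrite Ropp_involutive; exact H2.
    * apply opp2; rewrite Ropp_involutive; exact H1.
  + rewrite <- E1, <- E2, !Rbar_opp_involutive; auto.
- intros p; rewrite HS; split.
  + intros [t [H1 [H2 E]]]; exists (- t); repeat split.
    * apply opp1; rewrite Ropp_involutive; exact H2.
    * apply opp2; rewrite Ropp_involutive; exact H1.
    * rewrite Ropp_involutive, <- E; destruct p; simpl; f_equal; ring.
  + intros [t [H1 [H2 ->]]]; exists (- t); repeat split.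
    * apply opp2; exact H2.
    * apply opp1; exact H1.
    * simpl; rewrite Ropp_involutive; destruct (g (- t)); reflexivity.
Qed.

(** * Scalar equations *)

Lemma continuity_pt_of_derive (f : R -> R) (x : R) :
  ex_derive f x -> continuity_pt f x.
Proof.
intros [l H]; apply is_derive_Reals in H.
apply derivable_continuous_pt; exists l; exact H.
Qed.

(** Separation of variables: the travel time [T x] is the integral of [1 / f]
    from [0] to [x].  The bound on [f] is what excludes explosion in finite
    time, since then [T] grows at least like a multiple of [arcsinh]. *)
Lemma scalar_flow (f : R -> R) (c : R) : 0 < c ->
  (forall x, continuous f x) -> (forall x, 0 < f x) ->
  (forall x, f x <= c * sqrt (x ^ 2 + 1)) ->
  exists T u : R -> R,
    (forall x, is_derive T x (/ f x)) /\
    (forall x y, x < y -> T x < T y) /\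
    (forall t, T (u t) = t) /\ (forall x, u (T x) = x) /\
    (forall t, is_derive u t (f (u t))).
Proof.
intros c0 fc f0 fb.
assert (ic : forall x, continuous (fun s => / f s) x).
{ intros x; apply continuous_comp; [apply fc|].
  apply continuous_Rinv; specialize (f0 x); lra. }
set (T := fun x => RInt (fun s => / f s) 0 x : R).
assert (dT : forall x, is_derive T x (/ f x)).
{ intros x; apply (is_derive_RInt (fun s => / f s) T 0 x); [|apply ic].
  exists (mkposreal 1 Rlt_0_1); intros y _; apply (RInt_correct (V := R_CompleteNormedModule)).
  apply (ex_RInt_continuous (V := R_CompleteNormedModule)); intros; apply ic. }
assert (mT : forall x y, x < y -> T x < T y).
{ intros x y xy; apply (incr_function T m_infty p_infty (fun s => / f s)); simpl; auto.
  intros s _ _; apply Rinv_0_lt_compat, f0. }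
assert (T0 : T 0 = 0) by apply (RInt_point (V := R_CompleteNormedModule)).
set (S := fun x => T x - / (2 * c) * arcsinh x).
assert (dS : forall x, is_derive S x (/ f x - / (2 * c) * / sqrt (x ^ 2 + 1))).
{ intros x; apply (is_derive_minus T); [apply dT|].
  apply is_derive_scal, is_derive_Reals, derivable_pt_lim_arcsinh. }
assert (mS : forall x y, x < y -> S x < S y).
{ intros x y xy; apply (incr_function S m_infty p_infty _ (fun s _ _ => dS s)); simpl; auto.
  intros s _ _.
  assert (q0 : 0 < sqrt (s ^ 2 + 1)) by (apply sqrt_lt_R0; simpl; nra).
  specialize (f0 s); specialize (fb s); simpl in *.
  assert (cs : 0 < c * sqrt (s * (s * 1) + 1)) by (apply Rmult_lt_0_compat; assumption).
  rewrite <- Rinv_mult.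
  apply (proj2 (Rlt_0_minus _ _)), Rinv_lt_contravar; nra. }
assert (S0 : S 0 = 0) by (unfold S; rewrite T0, arcsinh_0; ring).
assert (surj : forall t, exists x, T x = t).
{ intros t; set (v := 2 * c * (Rabs t + 1)).
  assert (Pt := Rabs_pos t).
  assert (v0 : 0 < v) by (unfold v; nra).
  assert (s0 : 0 < sinh v) by (rewrite <- sinh_0; apply sinh_lt; exact v0).
  assert (s1 : sinh (- v) < 0) by (rewrite <- sinh_0; apply sinh_lt; lra).
  assert (Ev : / (2 * c) * v = Rabs t + 1) by (unfold v; field; lra).
  assert (B1 := mS _ _ s0); assert (B2 := mS _ _ s1).
  rewrite S0 in B1, B2; unfold S in B1, B2; rewrite arcsinh_sinh in B1, B2.
  rewrite <- Ropp_mult_distr_r in B2; rewrite Ev in B1, B2.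
  assert (Q := Rabs_le_between t (Rabs t)); destruct Q as [Q _].
  specialize (Q (Rle_refl _)).
  destruct (IVT_gen T (sinh (- v)) (sinh v) t) as [x [_ Ex]].
  - intros x; apply continuity_pt_of_derive.
    eexists; apply dT.
  - split.
    + eapply Rle_trans; [apply Rmin_l|lra].
    + eapply Rle_trans; [|apply Rmax_r]; lra.
  - exists x; exact Ex. }
set (u := fun t => proj1_sig (constructive_indefinite_description _ (surj t))).
assert (Tu : forall t, T (u t) = t).
{ intros t; unfold u; apply (proj2_sig (constructive_indefinite_description _ (surj t))). }
assert (inj : forall x y, T x < T y -> x < y).
{ intros x y H; destruct (Rtotal_order x y) as [l|[e|l]]; [exact l| |].
  - rewrite e in H; lra.
  - apply mT in l; lra. }
assert (uT : forall x, u (T x) = x).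
{ intros x; destruct (Rtotal_order (u (T x)) x) as [l|[e|l]]; [|exact e|];
    apply mT in l; rewrite Tu in l; lra. }
exists T, u; do 4 (split; [assumption|]).
intros t; rewrite <- (Rinv_inv (f (u t))).
apply (is_derive_inverse T); [apply dT| | |].
- apply Rinv_neq_0_compat; specialize (f0 (u t)); lra.
- apply continuous_of_eps; intros e e0.
  assert (L1 := mT (u t - e) (u t) ltac:(lra)).
  assert (L2 := mT (u t) (u t + e) ltac:(lra)).
  rewrite Tu in L1, L2.
  exists (Rmin (t - T (u t - e)) (T (u t + e) - t)); split.
  { apply Rmin_pos; lra. }
  intros y Hy.
  assert (H1 : Rabs (y - t) < t - T (u t - e))
    by (eapply Rlt_le_trans; [exact Hy|apply Rmin_l]).
  assert (H2 : Rabs (y - t) < T (u t + e) - t)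
    by (eapply Rlt_le_trans; [exact Hy|apply Rmin_r]).
  apply Rabs_def2 in H1; apply Rabs_def2 in H2.
  assert (K1 : u t - e < u y) by (apply inj; rewrite Tu; lra).
  assert (K2 : u y < u t + e) by (apply inj; rewrite Tu; lra).
  apply Rabs_def1; lra.
- apply filter_forall; exact Tu.
Qed.

(** If the speed is [p]-periodic, crossing one period always takes the same
    time, because [T (x + p) - T x] has derivative zero. *)
Lemma scalar_flow_periodic (f T u : R -> R) (p : R) :
  (forall x, f (x + p) = f x) ->
  (forall x, is_derive T x (/ f x)) ->
  (forall t, T (u t) = t) -> (forall x, u (T x) = x) ->
  forall t, u (t + (T p - T 0)) = u t + p.
Proof.
intros Hf dT Tu uT t.
assert (E : forall x, T (x + p) - T x = T (0 + p) - T 0).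
{ intros x; apply (constant_of_derive_0 m_infty p_infty (fun s => T (s + p) - T s));
    simpl; auto.
  intros s _ _; replace 0 with (1 * / f (s + p) - / f s) by (rewrite Hf; ring).
  apply (is_derive_minus (fun s => T (s + p))); [|apply dT].
  apply (is_derive_comp T (fun s => s + p)); [apply dT|auto_derive; auto]. }
specialize (E (u t)); rewrite Tu, Rplus_0_l in E.
rewrite <- (uT (u t + p)); f_equal; lra.
Qed.

(** * The equation y exp (- y) = q *)

(** On [y <= 1] the derivative [(1 - y) exp (- y)] dominates [(1 - y) / e],
    hence [y exp (- y)] grows at least like the parabola [(y - y ^ 2 / 2) / e]. *)
Lemma mul_exp_growth (y1 y2 : R) : y1 <= y2 -> y2 <= 1 ->
  exp (- (1)) * (y2 - y1) ^ 2 / 2 <= y2 * exp (- y2) - y1 * exp (- y1).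
Proof.
intros H12 H2.
assert (E0 := exp_pos (- (1))).
destruct (MVT_gen (fun y => y * exp (- y) - exp (- (1)) * (y - y ^ 2 / 2)) y1 y2
  (fun y => (1 - y) * (exp (- y) - exp (- (1))))) as [z [Hz E]].
- intros x _; auto_derive; auto; field.
- intros x _; apply continuity_pt_of_derive.
  auto_derive; auto.
- rewrite Rmin_left, Rmax_right in Hz by lra.
  assert (P : 0 <= (1 - z) * (exp (- z) - exp (- (1))) * (y2 - y1)).
  { apply Rmult_le_pos; [|lra]; apply Rmult_le_pos; [lra|].
    destruct (Req_dec z 1) as [->|N]; [lra|].
    assert (exp (- (1)) < exp (- z)) by (apply exp_increasing; lra). lra. }
  rewrite <- E in P.
  assert (0 <= exp (- (1)) * ((y2 - y1) * (1 - y2))).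
  { apply Rmult_le_pos; [lra|]; apply Rmult_le_pos; lra. }
  simpl in *; nra.
Qed.

Lemma mul_exp_solvable (q : R) :
  exists y, y <= 1 /\ y * exp (- y) = Rmin q (exp (- (1))).
Proof.
set (r := Rmin q (exp (- (1)))).
assert (Hr : r <= exp (- (1))) by apply Rmin_r.
destruct (Rle_lt_dec 0 r) as [r0|r0].
- destruct (IVT_gen (fun y => y * exp (- y)) 0 1 r) as [y [Hy E]].
  + intros x; apply continuity_pt_of_derive.
    auto_derive; auto.
  + rewrite Rmult_0_l, Rmult_1_l, Rmin_left, Rmax_right by lra; lra.
  + rewrite Rmin_left, Rmax_right in Hy by lra; exists y; split; [lra|exact E].
- assert (B : r * exp (- r) <= r).
  { assert (1 < exp (- r)) by (rewrite <- exp_0; apply exp_increasing; lra). nra. }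
  destruct (IVT_gen (fun y => y * exp (- y)) r 0 r) as [y [Hy E]].
  + intros x; apply continuity_pt_of_derive.
    auto_derive; auto.
  + rewrite Rmult_0_l, Rmin_left, Rmax_right by lra; lra.
  + rewrite Rmin_left, Rmax_right in Hy by lra; exists y; split; [lra|exact E].
Qed.

(** Minus the principal branch of the Lambert function at [- q], kept constant
    beyond the branch point [q = 1 / e] so as to be continuous on the line. *)
Definition lambert (q : R) : R :=
  proj1_sig (constructive_indefinite_description _ (mul_exp_solvable q)).

Lemma lambert_le_1 (q : R) : lambert q <= 1.
Proof.
unfold lambert.
apply (proj2_sig (constructive_indefinite_description _ (mul_exp_solvable q))).
Qed.

Lemma lambert_eq_min (q : R) :
  lambert q * exp (- lambert q) = Rmin q (exp (- (1))).
Proof.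
unfold lambert.
apply (proj2_sig (constructive_indefinite_description _ (mul_exp_solvable q))).
Qed.

Lemma lambert_eq (q : R) : q <= exp (- (1)) -> lambert q * exp (- lambert q) = q.
Proof. intros H; rewrite lambert_eq_min; apply Rmin_left; exact H. Qed.

Lemma mul_exp_inj (y1 y2 : R) : y1 <= 1 -> y2 <= 1 ->
  y1 * exp (- y1) = y2 * exp (- y2) -> y1 = y2.
Proof.
assert (E0 := exp_pos (- (1))).
assert (L : forall y1 y2, y1 < y2 -> y2 <= 1 -> y1 * exp (- y1) < y2 * exp (- y2)).
{ intros x y xy Hy; assert (G := mul_exp_growth x y ltac:(lra) Hy).
  assert (0 < (y - x) ^ 2) by (apply pow_lt; lra).
  assert (0 < exp (- (1)) * (y - x) ^ 2) by (apply Rmult_lt_0_compat; assumption).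
  lra. }
intros H1 H2 E; destruct (Rtotal_order y1 y2) as [l|[e|l]]; [|exact e|];
  apply L in l; lra.
Qed.

Lemma lambert_unique (y : R) : y <= 1 -> lambert (y * exp (- y)) = y.
Proof.
intros H; apply mul_exp_inj; [apply lambert_le_1|exact H|].
apply lambert_eq.
assert (G := mul_exp_growth y 1 H (Rle_refl 1)).
assert (0 <= exp (- (1)) * (1 - y) ^ 2)
  by (apply Rmult_le_pos; [left; apply exp_pos|apply pow2_ge_0]).
lra.
Qed.

Lemma lambert_at_branch : lambert (exp (- (1))) = 1.
Proof. rewrite <- (Rmult_1_l (exp (- (1)))); apply lambert_unique; lra. Qed.

Lemma lambert_lt_1 (q : R) : q < exp (- (1)) -> lambert q < 1.
Proof.
intros H; destruct (lambert_le_1 q) as [l|e]; [exact l|].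
generalize (lambert_eq q ltac:(lra)); rewrite e; lra.
Qed.

(** The growth estimate read backwards.  It makes [lambert] continuous, and at
    the branch point [q = 1 / e] it controls the speed of the flow near the
    stagnation point. *)
Lemma lambert_holder (q r : R) :
  exp (- (1)) * (lambert q - lambert r) ^ 2 / 2 <= Rabs (q - r).
Proof.
assert (L : forall q r, lambert r <= lambert q ->
  exp (- (1)) * (lambert q - lambert r) ^ 2 / 2 <= Rabs (q - r)).
{ clear; intros q r H.
  eapply Rle_trans; [apply (mul_exp_growth _ _ H (lambert_le_1 q))|].
  rewrite !lambert_eq_min.
  assert (A := Rle_abs (q - r)); assert (B := Rabs_pos (q - r)).
  unfold Rmin; destruct (Rle_dec q (exp (- (1)))), (Rle_dec r (exp (- (1)))); lra. }
destruct (Rle_lt_dec (lambert r) (lambert q)) as [H|H]; [apply L; exact H|].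
replace (lambert q - lambert r) with (- (lambert r - lambert q)) by ring.
rewrite Rabs_minus_sym; replace ((- (lambert r - lambert q)) ^ 2)
  with ((lambert r - lambert q) ^ 2) by ring.
apply L; lra.
Qed.

Lemma continuous_lambert (q : R) : continuous lambert q.
Proof.
assert (E0 := exp_pos (- (1))).
apply continuous_of_eps; intros e e0.
exists (exp (- (1)) * e ^ 2 / 2); split.
{ assert (0 < exp (- (1)) * e ^ 2)
    by (apply Rmult_lt_0_compat; [assumption|apply pow_lt; lra]). lra. }
intros r Hr; assert (G := lambert_holder r q).
set (d := lambert r - lambert q) in *.
assert (H : exp (- (1)) * d ^ 2 < exp (- (1)) * e ^ 2) by lra.
apply Rmult_lt_reg_l in H; [|exact E0].
apply Rabs_def1; simpl in H; nra.
Qed.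

Lemma is_derive_lambert (q : R) : q < exp (- (1)) ->
  is_derive lambert q (exp (lambert q) / (1 - lambert q)).
Proof.
intros H; assert (L := lambert_lt_1 q H).
assert (E0 := exp_pos (lambert q)).
replace (exp (lambert q) / (1 - lambert q))
  with (/ ((1 - lambert q) * exp (- lambert q)))
  by (rewrite exp_Ropp; field; lra).
apply (is_derive_inverse (fun y => y * exp (- y))).
- auto_derive; auto; ring.
- rewrite exp_Ropp; apply Rmult_integral_contrapositive_currified; [lra|].
  apply Rinv_neq_0_compat; lra.
- apply continuous_lambert.
- exists (mkposreal (exp (- (1)) - q) ltac:(lra)); intros r Hr.
  change (Rabs (r - q) < exp (- (1)) - q) in Hr; apply Rabs_def2 in Hr.
  apply lambert_eq; lra.
Qed.

(** * Regions *)

Lemma connected_interval (P Q : R -> Prop) :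
  open P -> open Q -> (forall t, 0 <= t <= 1 -> P t \/ Q t) -> P 0 -> Q 1 ->
  exists t, 0 <= t <= 1 /\ P t /\ Q t.
Proof.
intros oP oQ cov P0 Q1; apply NNPP; intros N.
set (E := fun t => 0 <= t <= 1 /\ forall s, 0 <= s <= t -> P s).
destruct (completeness E) as [l [Hub Hl]].
{ exists 1; intros t [Ht _]; lra. }
{ exists 0; split; [lra|]; intros s Hs; replace s with 0 by lra; exact P0. }
assert (l0 : 0 <= l).
{ apply Hub; split; [lra|]; intros s Hs; replace s with 0 by lra; exact P0. }
assert (l1 : l <= 1) by (apply Hl; intros t [Ht _]; lra).
assert (below : forall s, 0 <= s -> s < l -> P s).
{ intros s s0 sl; apply NNPP; intros NP.
  assert (l <= s); [|lra].
  apply Hl; intros t [Ht Pt]; destruct (Rle_lt_dec t s); [assumption|].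
  exfalso; apply NP, Pt; lra. }
assert (Pl : P l).
{ destruct (cov l ltac:(lra)) as [Pl|Ql]; [exact Pl|].
  destruct (oQ l Ql) as [d Hd]; assert (d0 := cond_pos d).
  destruct (Req_dec l 0) as [->|ln0]; [exact P0|].
  exfalso; apply N; exists (Rmax 0 (l - d / 2)).
  assert (M : 0 <= Rmax 0 (l - d / 2) < l /\ l - d / 2 <= Rmax 0 (l - d / 2)).
  { unfold Rmax; destruct (Rle_dec 0 (l - d / 2)); lra. }
  split; [lra|]; split; [apply below; lra|].
  apply Hd; change (Rabs (Rmax 0 (l - d / 2) - l) < d); apply Rabs_def1; lra. }
destruct (Req_dec l 1) as [->|ln1].
{ apply N; exists 1; split; [lra|]; split; assumption. }
destruct (oP l Pl) as [d Hd]; assert (d0 := cond_pos d).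
set (t := Rmin 1 (l + d / 2)).
assert (M : l < t <= 1 /\ t <= l + d / 2).
{ unfold t, Rmin; destruct (Rle_dec 1 (l + d / 2)); lra. }
assert (t <= l); [|lra].
apply Hub; split; [lra|]; intros s Hs.
destruct (Rlt_le_dec s l); [apply below; lra|].
apply Hd; change (Rabs (s - l) < d); apply Rabs_def1; lra.
Qed.

(** A star-shaped set is a union of segments from the origin, and two open sets
    that cover a segment and meet it at different ends overlap on it. *)
Lemma connected_star (U : C -> Prop) :
  (forall (w : C) (t : R), U w -> 0 <= t <= 1 -> U (t * fst w, t * snd w)) ->
  connected U.
Proof.
intros star A B oA oB cov [za [Uza Aza]] [zb [Uzb Bzb]].
set (ray := fun (w : C) (t : R) => (t * fst w, t * snd w) : C).
assert (c : forall (w : C) (V : C -> Prop), open V -> open (fun t => V (ray w t))).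
{ intros w V oV t Vt; apply oV in Vt.
  assert (Hc : @is_derive R_AbsRing C_R_NormedModule (ray w) t w).
  { apply is_derive_plane; simpl; split; auto_derive; auto; ring. }
  assert (K : continuous (U := C_R_NormedModule) (ray w) t).
  { apply (ex_derive_continuous (V := C_R_NormedModule)); exists w; exact Hc. }
  exact (K V Vt). }
assert (r1 : forall w, ray w 1 = w)
  by (intros w; apply injective_projections; simpl; ring).
assert (r0 : forall w, ray w 0 = RtoC 0)
  by (intros w; apply injective_projections; simpl; ring).
assert (cov' : forall w, U w -> forall t, 0 <= t <= 1 -> A (ray w t) \/ B (ray w t)).
{ intros w Uw t Ht; apply cov, star; assumption. }
destruct (cov' za Uza 0 ltac:(lra)) as [A0|B0].
- destruct (connected_interval _ _ (c zb A oA) (c zb B oB)) as [t [Ht [At Bt]]].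
  + apply cov'; exact Uzb.
  + rewrite r0, <- (r0 za); exact A0.
  + rewrite r1; exact Bzb.
  + exists (ray zb t); split; [apply star; assumption|]; auto.
- destruct (connected_interval _ _ (c za B oB) (c za A oA)) as [t [Ht [Bt At]]].
  + intros t Ht; destruct (cov' za Uza t Ht); auto.
  + exact B0.
  + rewrite r1; exact Aza.
  + exists (ray za t); split; [apply star; assumption|]; auto.
Qed.

(** The level set of the stream function at level [kap a ln (a m)], cut at the
    height of the stagnation point to discard its unbounded part. *)
Definition rim (a m : R) (p : C) : Prop :=
  snd p <= a /\ Cmod p = a * m * exp (snd p / a).

Definition eye (a m : R) (p : C) : Prop :=
  snd p < a /\ Cmod p < a * m * exp (snd p / a).

Lemma Cmod_ray (p : C) (t : R) : 0 <= t ->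
  Cmod (t * fst p, t * snd p) = t * Cmod p.
Proof.
intros t0; rewrite <- (Rabs_pos_eq t t0) at 3; rewrite <- Cmod_R, <- Cmod_mult.
f_equal; apply injective_projections; simpl; ring.
Qed.

(** This is what makes [eye] star-shaped: the bound [a m exp (y / a)] shrinks
    more slowly than the modulus along a ray run towards the origin.  It comes
    from the tangent line bound [1 - (1 - t) y <= exp (- (1 - t) y)]. *)
Lemma ray_exp_le (t y : R) : 0 <= t <= 1 -> y <= 1 -> t * exp y <= exp (t * y).
Proof.
intros Ht Hy; replace (exp (t * y)) with (exp (- (1 - t) * y) * exp y)
  by (rewrite <- exp_plus; f_equal; ring).
apply Rmult_le_compat_r; [left; apply exp_pos|].
assert (H := exp_ineq1_le (- (1 - t) * y)); nra.
Qed.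

Lemma ray_exp_lt (t y : R) : 0 <= t < 1 -> y <= 1 -> t * exp y < exp (t * y).
Proof.
intros Ht Hy; replace (exp (t * y)) with (exp (- (1 - t) * y) * exp y)
  by (rewrite <- exp_plus; f_equal; ring).
apply Rmult_lt_compat_r; [apply exp_pos|].
destruct (Req_dec y 0) as [->|N].
- rewrite Rmult_0_r, exp_0; lra.
- assert (H := exp_ineq1 (- (1 - t) * y)).
  assert (- (1 - t) * y <> 0) by (apply Rmult_integral_contrapositive_currified; lra).
  specialize (H H0); nra.
Qed.

Lemma continuous_Cmod (p : C) : @continuous C_UniformSpace R_UniformSpace Cmod p.
Proof.
apply filterlim_locally; intros e.
apply locally_C_disc; exists e; split; [apply cond_pos|]; intros w Hw.
change (Rabs (Cmod w - Cmod p) < e).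
assert (T1 := Cmod_triangle p (w - p)%C); assert (T2 := Cmod_triangle w (- (w - p))%C).
replace (p + (w - p))%C with w in T1 by ring.
replace (w + - (w - p))%C with p in T2 by ring.
rewrite Cmod_opp in T2; apply Rabs_def1; lra.
Qed.

Lemma continuous_rim_gap (a m : R) (p : C) :
  @continuous C_UniformSpace R_UniformSpace
    (fun w : C => Cmod w - a * m * exp (snd w / a)) p.
Proof.
apply (continuous_minus (V := R_NormedModule) Cmod); [apply continuous_Cmod|].
apply (continuous_comp (snd : C -> R) (fun y => a * m * exp (y / a)));
  [apply continuous_snd|].
apply (ex_derive_continuous (V := R_NormedModule)); auto_derive; auto.
Qed.

Lemma open_preimage (f : C -> R) (V : R -> Prop) :
  (forall p, @continuous C_UniformSpace R_UniformSpace f p) -> open V ->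
  @open C_UniformSpace (fun p => V (f p)).
Proof. intros Hf HV; apply open_comp; [intros p _; apply Hf|exact HV]. Qed.

Lemma open_eye (a m : R) : @open C_UniformSpace (eye a m).
Proof.
apply open_and.
- apply (open_preimage snd (fun y => y < a)); [intros p; apply continuous_snd|].
  apply open_lt.
- apply (open_ext (fun p : C => Cmod p - a * m * exp (snd p / a) < 0)).
  + intros p; lra.
  + apply (open_preimage (fun p : C => Cmod p - a * m * exp (snd p / a))
      (fun y => y < 0)); [apply continuous_rim_gap|apply open_lt].
Qed.

Lemma eye_star (a m : R) (w : C) (t : R) : 0 < a -> 0 < m ->
  eye a m w -> 0 <= t <= 1 -> eye a m (t * fst w, t * snd w).
Proof.
intros a0 m0 [H1 H2] Ht; split; simpl.
- destruct (Rle_lt_dec (snd w) 0); nra.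
- rewrite Cmod_ray by lra.
  assert (am : 0 < a * m) by (apply Rmult_lt_0_compat; assumption).
  destruct (Req_dec t 0) as [->|N].
  { rewrite Rmult_0_l; apply Rmult_lt_0_compat; [exact am|apply exp_pos]. }
  apply Rlt_le_trans with (a * m * (t * exp (snd w / a))); [nra|].
  apply Rmult_le_compat_l; [lra|].
  replace (t * snd w / a) with (t * (snd w / a)) by (field; lra).
  apply ray_exp_le; [exact Ht|].
  apply Rmult_le_reg_r with a; [exact a0|]; field_simplify; lra.
Qed.

(** Points of the rim are limits of the points [(1 - h) p] of their rays, which
    lie in the eye by [ray_exp_lt].  Conversely a boundary point satisfies the
    two inequalities of the eye in the weak sense but not both strictly. *)
Lemma boundary_eye (a m : R) (p : C) : 0 < a -> 0 < m <= exp (- (1)) ->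
  boundary (eye a m) p <-> rim a m p.
Proof.
intros a0 [m0 m1]; split.
- intros Hb.
  assert (H1 : snd p <= a).
  { destruct (Rle_lt_dec (snd p) a) as [l|l]; [exact l|].
    destruct (Hb (fun w => a < snd w)) as [[w [W1 [W2 _]]] _]; [|lra].
    apply (open_preimage snd (fun y => a < y)); [intros q; apply continuous_snd| |exact l].
    apply open_gt. }
  assert (H2 : Cmod p <= a * m * exp (snd p / a)).
  { destruct (Rle_lt_dec (Cmod p) (a * m * exp (snd p / a))) as [l|l]; [exact l|].
    destruct (Hb (fun w => 0 < Cmod w - a * m * exp (snd w / a)))
      as [[w [W1 [_ W2]]] _]; [|lra].
    apply (open_preimage (fun w : C => Cmod w - a * m * exp (snd w / a))
      (fun y => 0 < y)); [apply continuous_rim_gap|apply open_gt|lra]. }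
  assert (H3 : ~ eye a m p).
  { intros H; destruct (Hb (eye a m)) as [_ [w [W1 W2]]]; [|tauto].
    apply open_eye; exact H. }
  split; [exact H1|]; apply Rle_antisym; [exact H2|].
  apply Rnot_lt_le; intros H4; apply H3; split; [|exact H4].
  (* at the height [a] itself the bound forces [Cmod p < a], which is absurd *)
  destruct H1 as [l|e]; [exact l|exfalso].
  rewrite e in H4; unfold Rdiv in H4; rewrite Rinv_r in H4 by lra.
  assert (E : exp (- (1)) * exp 1 = 1)
    by (rewrite <- exp_plus, <- exp_0; f_equal; ring).
  assert (M := Rmax_Cmod p); assert (M' := Rmax_r (Rabs (fst p)) (Rabs (snd p))).
  assert (M2 := Rle_abs (snd p)).
  assert (m * exp 1 <= exp (- (1)) * exp 1)
    by (apply Rmult_le_compat_r; [left; apply exp_pos|lra]).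
  nra.
- intros [H1 H2] V HV; split.
  + apply locally_C_disc in HV; destruct HV as [d [d0 Hd]].
    assert (P0 := Cmod_ge_0 p).
    set (h := Rmin 1 (d / (2 * (Cmod p + 1)))).
    assert (h0 : 0 < h).
    { apply Rmin_pos; [lra|]; apply Rdiv_lt_0_compat; lra. }
    assert (h1 : h <= 1) by apply Rmin_l.
    assert (h2 : h * (2 * (Cmod p + 1)) <= d).
    { apply Rle_trans with (d / (2 * (Cmod p + 1)) * (2 * (Cmod p + 1))).
      - apply Rmult_le_compat_r; [lra|apply Rmin_r].
      - right; field; lra. }
    exists ((1 - h) * fst p, (1 - h) * snd p); split; [apply Hd|split; simpl].
    * replace (((1 - h) * fst p, (1 - h) * snd p)%R - p)%C
        with (- (h * fst p, h * snd p)%R)%C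
        by (apply injective_projections; simpl; ring).
      rewrite Cmod_opp, Cmod_ray by lra; nra.
    * destruct (Rle_lt_dec (snd p) 0); nra.
    * rewrite Cmod_ray, H2 by lra.
      replace ((1 - h) * snd p / a) with ((1 - h) * (snd p / a)) by (field; lra).
      replace ((1 - h) * (a * m * exp (snd p / a)))
        with (a * m * ((1 - h) * exp (snd p / a))) by ring.
      apply Rmult_lt_compat_l; [apply Rmult_lt_0_compat; assumption|].
      apply ray_exp_lt; [lra|].
      apply Rmult_le_reg_r with a; [exact a0|]; field_simplify; lra.
  + exists p; split; [apply locally_singleton; exact HV|].
    intros [_ H]; lra.
Qed.

Lemma bounds_rim_eye (a m : R) : 0 < a -> 0 < m <= exp (- (1)) ->
  bounds (rim a m) (eye a m).
Proof.
intros a0 Hm; split; [apply open_eye|split; [|split]].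
- apply connected_star; intros w t Hw Ht; apply eye_star; tauto.
- exists (a * m * exp 1); intros z [H1 H2].
  left; eapply Rlt_le_trans; [exact H2|].
  apply Rmult_le_compat_l; [apply Rmult_le_pos; lra|].
  assert (z1 : snd z / a < 1).
  { apply Rmult_lt_reg_r with a; [exact a0|]; field_simplify; lra. }
  left; apply exp_increasing; exact z1.
- intros z; apply boundary_eye; assumption.
Qed.

Lemma eye_0 (a m : R) : 0 < a -> 0 < m -> eye a m (RtoC 0).
Proof.
intros a0 m0; split; [exact a0|].
rewrite Cmod_0; apply Rmult_lt_0_compat;
  [apply Rmult_lt_0_compat; assumption|apply exp_pos].
Qed.

(** * Loops *)

(** The point of the rim in the direction [(c, s)]: with [y = snd p / a] the
    equation of the rim reads [y exp (- y) = m s], so [y = lambert (m s)]. *)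
Definition loop_point (a m c s : R) : C :=
  (a * m * exp (lambert (m * s)) * c, a * m * exp (lambert (m * s)) * s).

Lemma unit_le_1 (c s : R) : c ^ 2 + s ^ 2 = 1 -> s <= 1.
Proof. intros H; nra. Qed.

Lemma lambert_self (q : R) : q <= exp (- (1)) -> q * exp (lambert q) = lambert q.
Proof.
intros H; rewrite <- (lambert_eq q H) at 1.
rewrite Rmult_assoc, <- exp_plus, Rplus_opp_l, exp_0; ring.
Qed.

Lemma loop_level (m c s : R) : 0 < m <= exp (- (1)) -> c ^ 2 + s ^ 2 = 1 ->
  m * s <= exp (- (1)).
Proof. intros Hm H; apply unit_le_1 in H; nra. Qed.

Lemma snd_loop_point (a m c s : R) : 0 < m <= exp (- (1)) -> c ^ 2 + s ^ 2 = 1 ->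
  snd (loop_point a m c s) = a * lambert (m * s).
Proof.
intros Hm H; simpl.
rewrite <- (lambert_self (m * s)) at 2 by (eapply loop_level; eassumption).
ring.
Qed.

Lemma norm2_loop_point (a m c s : R) : c ^ 2 + s ^ 2 = 1 ->
  fst (loop_point a m c s) ^ 2 + snd (loop_point a m c s) ^ 2
  = (a * m * exp (lambert (m * s))) ^ 2.
Proof.
intros H; simpl fst; simpl snd.
transitivity ((a * m * exp (lambert (m * s))) ^ 2 * (c ^ 2 + s ^ 2));
  [ring|rewrite H; ring].
Qed.

Lemma Cmod_loop_point (a m c s : R) : 0 < a -> 0 < m -> c ^ 2 + s ^ 2 = 1 ->
  Cmod (loop_point a m c s) = a * m * exp (lambert (m * s)).
Proof.
intros a0 m0 H; unfold Cmod; rewrite norm2_loop_point by exact H.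
apply sqrt_pow2; left.
apply Rmult_lt_0_compat; [apply Rmult_lt_0_compat; assumption|apply exp_pos].
Qed.

Lemma rim_loop_point (a m c s : R) : 0 < a -> 0 < m <= exp (- (1)) ->
  c ^ 2 + s ^ 2 = 1 -> rim a m (loop_point a m c s).
Proof.
intros a0 Hm H; unfold rim.
rewrite snd_loop_point, Cmod_loop_point by tauto; split.
- assert (L := lambert_le_1 (m * s)); nra.
- do 2 f_equal; field; lra.
Qed.

Lemma loop_point_of_rim (a m : R) (p : C) : 0 < a -> 0 < m -> rim a m p ->
  exists c s, c ^ 2 + s ^ 2 = 1 /\ p = loop_point a m c s /\
    m * s = snd p / a * exp (- (snd p / a)).
Proof.
intros a0 m0 [H1 H2].
assert (E0 := exp_pos (snd p / a)).
assert (r0 : 0 < Cmod p).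
{ rewrite H2; apply Rmult_lt_0_compat; [apply Rmult_lt_0_compat|]; assumption. }
assert (L : snd p / a <= 1).
{ apply Rmult_le_reg_r with a; [exact a0|]; field_simplify; lra. }
assert (N : fst p ^ 2 + snd p ^ 2 = Cmod p ^ 2).
{ unfold Cmod; rewrite pow2_sqrt; [reflexivity|].
  assert (A := pow2_ge_0 (fst p)); assert (B := pow2_ge_0 (snd p)); lra. }
assert (E : m * (snd p / Cmod p) = snd p / a * exp (- (snd p / a))).
{ rewrite H2, exp_Ropp; field; lra. }
exists (fst p / Cmod p), (snd p / Cmod p); split; [|split; [|exact E]].
- transitivity ((fst p ^ 2 + snd p ^ 2) / Cmod p ^ 2); [field; lra|].
  rewrite N; field; lra.
- unfold loop_point; rewrite E, lambert_unique, <- H2 by exact L.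
  apply injective_projections; simpl; field; lra.
Qed.

(** The rate at which the parameter [x] of a direction [(c x, s x)] turning
    clockwise with angular velocity [om x] must advance for the loop to be run
    through at the speed of the flow. *)
Definition loop_speed (kap a m : R) (s om : R -> R) (x : R) : R :=
  kap / a * (1 - lambert (m * s x)) / ((m * exp (lambert (m * s x))) ^ 2 * om x).

(** With [e = exp Y] the equation [Y = m s e] of the loop turns the chain rule
    into the two components of the field; the factor [1 - Y] of the speed
    cancels the denominator of the derivative of [lambert]. *)
Lemma is_derive_loop (kap a m : R) (c s om : R -> R) (u : R -> R) (t : R) :
  0 < a -> 0 < m <= exp (- (1)) ->
  (forall x, c x ^ 2 + s x ^ 2 = 1) ->
  (forall x, is_derive c x (om x * s x)) ->
  (forall x, is_derive s x (- om x * c x)) ->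
  (forall x, 0 < om x) -> (forall x, m * s x < exp (- (1))) ->
  is_derive u t (loop_speed kap a m s om (u t)) ->
  @is_derive R_AbsRing C_R_NormedModule
    (fun t => loop_point a m (c (u t)) (s (u t))) t
    (vortex_flow kap a (loop_point a m (c (u t)) (s (u t)))).
Proof.
intros a0 Hm Hcs dc ds om0 Hlt du.
assert (L := lambert_lt_1 _ (Hlt (u t))).
assert (N := norm2_loop_point a m _ _ (Hcs (u t))).
assert (S := lambert_self _ (Rlt_le _ _ (Hlt (u t)))).
assert (dl : is_derive (fun x => lambert (m * s x)) (u t)
  (m * (- om (u t) * c (u t)) *
     (exp (lambert (m * s (u t))) / (1 - lambert (m * s (u t)))))).
{ apply (is_derive_comp lambert (fun x => m * s x));
    [apply is_derive_lambert, Hlt|].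
  apply is_derive_scal, ds. }
assert (dr : forall (f : R -> R) l, is_derive f (u t) l ->
  is_derive (fun r => a * m * exp (lambert (m * s (u r))) * f (u r)) t
   (a * m * exp (lambert (m * s (u t))) *
     (m * (- om (u t) * c (u t)) *
       (exp (lambert (m * s (u t))) / (1 - lambert (m * s (u t)))) * f (u t) + l)
    * loop_speed kap a m s om (u t))).
{ intros f l df.
  set (Lm := fun x => lambert (m * s x)) in *.
  change (is_derive (fun r => a * m * exp (Lm (u r)) * f (u r)) t
   (a * m * exp (Lm (u t)) *
     (m * (- om (u t) * c (u t)) *
       (exp (Lm (u t)) / (1 - Lm (u t))) * f (u t) + l)
    * loop_speed kap a m s om (u t))).
  auto_derive.
  - repeat split; eexists; eassumption.
  - change (Derive (fun x : R => Lm x)) with (Derive Lm).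
    change (Derive (fun x : R => f x)) with (Derive f).
    change (Derive (fun x : R => u x)) with (Derive u).
    rewrite (is_derive_unique u _ _ du), (is_derive_unique Lm _ _ dl),
      (is_derive_unique f _ _ df).
    unfold Lm; ring. }
apply is_derive_plane; split.
- replace (fst (vortex_flow _ _ _)) with (a * m * exp (lambert (m * s (u t))) *
     (m * (- om (u t) * c (u t)) *
       (exp (lambert (m * s (u t))) / (1 - lambert (m * s (u t)))) * c (u t)
        + om (u t) * s (u t)) * loop_speed kap a m s om (u t)).
  { apply (dr c), dc. }
  assert (J1 : forall p, fst (vortex_flow kap a p)
    = kap * (- 1 + a * (snd p / (fst p ^ 2 + snd p ^ 2)))) by reflexivity.
  rewrite J1, N, snd_loop_point by auto.
  unfold loop_speed.
  specialize (om0 (u t)); specialize (Hcs (u t)).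
  set (y := lambert (m * s (u t))) in *; clearbody y.
  assert (E0 := exp_pos y); set (e := exp y) in *; clearbody e.
  assert (Es : s (u t) = y / (m * e)) by (rewrite <- S; field; lra).
  assert (Ec : c (u t) * c (u t) = 1 - s (u t) * s (u t)) by (simpl in Hcs; lra).
  transitivity (kap * ((1 - y) * s (u t) / (m * e) - c (u t) * c (u t)));
    [field; repeat split; lra|].
  rewrite Ec, Es; field; repeat split; lra.
- replace (snd (vortex_flow _ _ _)) with (a * m * exp (lambert (m * s (u t))) *
     (m * (- om (u t) * c (u t)) *
       (exp (lambert (m * s (u t))) / (1 - lambert (m * s (u t)))) * s (u t)
        + - om (u t) * c (u t)) * loop_speed kap a m s om (u t)).
  { apply (dr s), ds. }
  assert (J2 : forall p, snd (vortex_flow kap a p)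
    = kap * (- a * (fst p / (fst p ^ 2 + snd p ^ 2)))) by reflexivity.
  rewrite J2, N; simpl fst.
  unfold loop_speed.
  specialize (om0 (u t)); specialize (Hcs (u t)).
  set (y := lambert (m * s (u t))) in *; clearbody y.
  assert (E0 := exp_pos y); set (e := exp y) in *; clearbody e.
  assert (Es : m * s (u t) * e - y = 0) by lra.
  transitivity (kap * (- c (u t) * ((m * s (u t) * e + 1 - y) / (m * e)))).
  + field; repeat split; lra.
  + replace (m * s (u t) * e + 1 - y) with 1 by lra; field; repeat split; lra.
Qed.

Lemma continuous_loop_speed (kap a m : R) (s om : R -> R) (x : R) :
  0 < m -> 0 < om x -> continuous s x -> continuous om x ->
  continuous (loop_speed kap a m s om) x.
Proof.
intros m0 om0 cs co.
assert (cl : continuous (fun x => lambert (m * s x)) x).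
{ apply (continuous_comp (fun x => m * s x) lambert); [|apply continuous_lambert].
  apply (continuous_scal_r m s); exact cs. }
assert (ce : continuous (fun y => m * exp (lambert (m * s y))) x).
{ apply (continuous_scal_r m (fun y => exp (lambert (m * s y)))).
  apply (continuous_comp (fun y => lambert (m * s y)) exp); [exact cl|].
  apply continuous_exp. }
unfold loop_speed, Rdiv; apply (continuous_mult (K := R_AbsRing)).
- apply (continuous_scal_r (kap * / a) (fun y => 1 - lambert (m * s y))).
  apply (continuous_minus (V := R_NormedModule) (fun _ => 1)); [apply continuous_const|exact cl].
- apply continuous_Rinv_comp.
  + apply (continuous_mult (K := R_AbsRing)); [|exact co].
    apply (continuous_ext (fun y => m * exp (lambert (m * s y)) * (m * exp (lambert (m * s y))))).
    { intros y; simpl; ring. }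
    apply (continuous_mult (K := R_AbsRing)); exact ce.
  + assert (E0 := exp_pos (lambert (m * s x))).
    assert (0 < (m * exp (lambert (m * s x))) ^ 2)
      by (apply pow_lt, Rmult_lt_0_compat; assumption).
    apply Rmult_integral_contrapositive_currified; lra.
Qed.

Lemma lambert_ge_m1 (q : R) : - exp (- (1)) <= q <= exp (- (1)) -> - 1 <= lambert q.
Proof.
intros H.
assert (E : exp (- (1)) * exp 1 = 1)
  by (rewrite <- exp_plus, <- exp_0; f_equal; ring).
rewrite <- lambert_self by lra.
assert (L : exp (lambert q) <= exp 1).
{ destruct (lambert_le_1 q) as [l|e]; [left; apply exp_increasing, l|rewrite e; lra]. }
assert (E0 := exp_pos (lambert q)).
assert (- exp (- (1)) * exp (lambert q) <= q * exp (lambert q))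
  by (apply Rmult_le_compat_r; lra).
assert (exp (- (1)) * exp (lambert q) <= exp (- (1)) * exp 1)
  by (apply Rmult_le_compat_l; [left; apply exp_pos|exact L]).
lra.
Qed.

(** The bound on [1 - lambert (m s)] is the linear growth of the speed: the
    remaining factor [(m exp Y) ^ 2] of its denominator is bounded below. *)
Lemma loop_solution (kap a m B : R) (c s om : R -> R) :
  0 < kap -> 0 < a -> 0 < m <= exp (- (1)) -> 0 < B ->
  (forall x, c x ^ 2 + s x ^ 2 = 1) ->
  (forall x, is_derive c x (om x * s x)) ->
  (forall x, is_derive s x (- om x * c x)) ->
  (forall x, 0 < om x) -> (forall x, m * s x < exp (- (1))) ->
  (forall x, continuous om x) ->
  (forall x, 1 - lambert (m * s x) <= B * om x * sqrt (x ^ 2 + 1)) ->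
  exists T u : R -> R,
    (forall x, is_derive T x (/ loop_speed kap a m s om x)) /\
    (forall x y, x < y -> T x < T y) /\
    (forall t, T (u t) = t) /\ (forall x, u (T x) = x) /\
    forall t, @is_derive R_AbsRing C_R_NormedModule
      (fun t => loop_point a m (c (u t)) (s (u t))) t
      (vortex_flow kap a (loop_point a m (c (u t)) (s (u t)))).
Proof.
intros k0 a0 Hm B0 Hcs dc ds om0 Hlt com HB.
assert (ka : 0 < kap / a) by (apply Rdiv_lt_0_compat; assumption).
assert (W : forall x, exp (- (1)) <= exp (lambert (m * s x))).
{ intros x; assert (L : - 1 <= lambert (m * s x)).
  { apply lambert_ge_m1; specialize (Hlt x); split; [|lra].
    assert (Hcs' := Hcs x); assert (- 1 <= s x) by nra; nra. }
  destruct L as [l|e]; [left; apply exp_increasing; lra|].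
  rewrite <- e; right; f_equal; ring. }
assert (E0 := exp_pos (- (1))).
assert (mE : 0 < m * exp (- (1))) by (apply Rmult_lt_0_compat; tauto).
set (K := kap / a * B / (m * exp (- (1))) ^ 2).
assert (K0 : 0 < K).
{ apply Rdiv_lt_0_compat; [apply Rmult_lt_0_compat; assumption|apply pow_lt, mE]. }
destruct (scalar_flow (loop_speed kap a m s om) K K0) as [T [u [H1 [H2 [H3 [H4 H5]]]]]].
- intros x; apply continuous_loop_speed; [tauto|apply om0| |apply com].
  apply (ex_derive_continuous (V := R_NormedModule)); eexists; apply ds.
- intros x; unfold loop_speed.
  assert (L := lambert_lt_1 _ (Hlt x)).
  apply Rdiv_lt_0_compat; [apply Rmult_lt_0_compat; [exact ka|lra]|].
  apply Rmult_lt_0_compat; [|apply om0].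
  apply pow_lt, Rmult_lt_0_compat; [tauto|apply exp_pos].
- intros x; unfold loop_speed, K.
  set (y := lambert (m * s x)) in *; specialize (W x); fold y in W.
  specialize (HB x); fold y in HB; specialize (om0 x).
  assert (Q : 0 < (m * exp (- (1))) ^ 2) by apply pow_lt, mE.
  assert (P : (m * exp (- (1))) ^ 2 <= (m * exp y) ^ 2).
  { apply pow_incr; split; [lra|]; apply Rmult_le_compat_l; lra. }
  assert (R0 := sqrt_pos (x ^ 2 + 1)).
  set (r := sqrt (x ^ 2 + 1)) in *.
  set (d := (m * exp (- (1))) ^ 2) in *; set (d' := (m * exp y) ^ 2) in *.
  apply Rle_trans with (kap / a * (B * om x * r) / (d' * om x)).
  + unfold Rdiv; apply Rmult_le_compat_r.
    { left; apply Rinv_0_lt_compat, Rmult_lt_0_compat; lra. }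
    apply Rmult_le_compat_l; [left; exact ka|exact HB].
  + replace (kap / a * (B * om x * r) / (d' * om x))
      with (kap / a * B * r * / d') by (field; lra).
    replace (kap / a * B / d * r) with (kap / a * B * r * / d) by (field; lra).
    apply Rmult_le_compat_l.
    { apply Rmult_le_pos; [apply Rmult_le_pos; lra|exact R0]. }
    apply Rinv_le_contravar; assumption.
- exists T, u; do 4 (split; [assumption|]).
  intros t; apply (is_derive_loop kap a m c s om u t); auto.
Qed.

Lemma loop_point_neq_0 (a m c s : R) : 0 < a -> 0 < m -> c ^ 2 + s ^ 2 = 1 ->
  loop_point a m c s <> RtoC 0.
Proof.
intros a0 m0 H; apply Cmod_gt_0; rewrite Cmod_loop_point by assumption.
apply Rmult_lt_0_compat; [apply Rmult_lt_0_compat; assumption|apply exp_pos].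
Qed.

Lemma loop_point_inj (a m c s c' s' : R) : 0 < a -> 0 < m <= exp (- (1)) ->
  c ^ 2 + s ^ 2 = 1 -> c' ^ 2 + s' ^ 2 = 1 ->
  loop_point a m c s = loop_point a m c' s' -> c = c' /\ s = s'.
Proof.
intros a0 Hm H H' E.
assert (E2 := f_equal snd E); rewrite !snd_loop_point in E2 by assumption.
apply Rmult_eq_reg_l in E2; [|lra].
assert (Es : s = s').
{ apply Rmult_eq_reg_l with m; [|lra].
  rewrite <- (lambert_eq (m * s)), <- (lambert_eq (m * s')), E2
    by (eapply loop_level; eassumption); reflexivity. }
split; [|exact Es]; subst s'.
assert (E1 := f_equal fst E); simpl in E1.
apply Rmult_eq_reg_l in E1; [exact E1|].
assert (0 < a * m * exp (lambert (m * s)));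
  [|lra].
apply Rmult_lt_0_compat; [apply Rmult_lt_0_compat; tauto|apply exp_pos].
Qed.

Lemma angle_exists (c s : R) : c ^ 2 + s ^ 2 = 1 ->
  exists x, 0 <= x < 2 * PI /\ cos x = c /\ sin x = s.
Proof.
intros H; assert (Hc : - 1 <= c <= 1) by nra.
assert (B := acos_bound c); assert (P := PI_RGT_0).
assert (Q : sqrt (1 - Rsqr c) = Rabs s).
{ rewrite <- sqrt_Rsqr_abs; f_equal; unfold Rsqr; simpl in H; lra. }
destruct (Rle_lt_dec 0 s) as [s0|s0].
- exists (acos c); split; [lra|]; rewrite cos_acos, sin_acos, Q by exact Hc.
  split; [reflexivity|apply Rabs_pos_eq; exact s0].
- exists (2 * PI - acos c).
  assert (C1 : cos (2 * PI - acos c) = c).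
  { rewrite cos_minus, cos_2PI, sin_2PI, cos_acos by exact Hc; ring. }
  assert (S1 : sin (2 * PI - acos c) = s).
  { rewrite sin_minus, cos_2PI, sin_2PI, sin_acos, Q by exact Hc.
    rewrite Rabs_left by exact s0; ring. }
  split; [|split; assumption]; split; [lra|].
  destruct (Req_dec (acos c) 0) as [Z|Z]; [|lra].
  rewrite Z, Rminus_0_r, sin_2PI in S1; lra.
Qed.

(** With [d = y - x] the hypotheses give [cos d = 1], that is
    [sin (d / 2) = 0], while [d / 2] lies strictly between [0] and [PI]. *)
Lemma angle_unique (x y : R) : 0 <= x < 2 * PI -> 0 <= y < 2 * PI ->
  cos x = cos y -> sin x = sin y -> x = y.
Proof.
intros Hx Hy Ec Es.
assert (L : forall x y, 0 <= x < 2 * PI -> 0 <= y < 2 * PI ->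
  cos x = cos y -> sin x = sin y -> ~ x < y).
{ clear; intros x y Hx Hy Ec Es l.
  assert (H : 0 < sin ((y - x) / 2)) by (apply sin_gt_0; lra).
  assert (E : cos (y - x) = 1).
  { rewrite cos_minus, Ec, Es, <- (sin2_cos2 y); unfold Rsqr; ring. }
  replace (y - x) with (2 * ((y - x) / 2)) in E by field.
  rewrite cos_2a_sin in E; nra. }
destruct (Rtotal_order x y) as [l|[e|l]]; [|exact e|].
- exfalso; apply (L x y); assumption.
- exfalso; apply (L y x); auto.
Qed.

Lemma continuous_loop_point (a m : R) (c s : R -> R) (x : R) :
  continuous c x -> continuous s x ->
  @continuous R_UniformSpace C_UniformSpace (fun x => loop_point a m (c x) (s x)) x.
Proof.
intros cc cs.
assert (ce : continuous (fun x => a * m * exp (lambert (m * s x))) x).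
{ apply (continuous_scal_r (a * m) (fun x => exp (lambert (m * s x)))).
  apply (continuous_comp (fun x => lambert (m * s x)) exp); [|apply continuous_exp].
  apply (continuous_comp (fun x => m * s x) lambert); [|apply continuous_lambert].
  apply (continuous_scal_r m s); exact cs. }
assert (c1 : continuous (fun x => a * m * exp (lambert (m * s x)) * c x) x)
  by (apply (continuous_mult (K := R_AbsRing)); assumption).
assert (c2 : continuous (fun x => a * m * exp (lambert (m * s x)) * s x) x)
  by (apply (continuous_mult (K := R_AbsRing)); assumption).
apply filterlim_locally; intros e.
generalize (filter_and _ _ (proj1 (filterlim_locally _ _) c1 e)
  (proj1 (filterlim_locally _ _) c2 e)).
apply filter_imp; intros y [H1 H2]; split; assumption.
Qed.

Lemma simple_closed_curve_rim (a m : R) : 0 < a -> 0 < m <= exp (- (1)) ->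
  simple_closed_curve (rim a m).
Proof.
intros a0 Hm; assert (P := PI_RGT_0).
assert (U : forall x, cos x ^ 2 + sin x ^ 2 = 1).
{ intros x; rewrite <- (sin2_cos2 x); unfold Rsqr; ring. }
exists (fun r => loop_point a m (cos (2 * PI * r)) (sin (2 * PI * r))).
split; [|split; [|split]].
- intros x _; apply (filterlim_filter_le_1 (F := locally x)); [apply filter_le_within|].
  apply (continuous_loop_point a m (fun r => cos (2 * PI * r))
    (fun r => sin (2 * PI * r)));
    apply (ex_derive_continuous (V := R_NormedModule)); auto_derive; auto.
- rewrite Rmult_0_r, Rmult_1_r, cos_2PI, sin_2PI, cos_0, sin_0; reflexivity.
- intros r t Hr Ht E; apply loop_point_inj in E; auto.
  assert (H : 2 * PI * r = 2 * PI * t) by (apply angle_unique; tauto || nra).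
  apply Rmult_eq_reg_l in H; lra.
- intros z; split.
  + intros Hz; destruct (loop_point_of_rim a m z) as [c [s [H [-> _]]]]; try tauto.
    destruct (angle_exists c s H) as [x [Hx [<- <-]]].
    exists (x / (2 * PI)).
    replace (2 * PI * (x / (2 * PI))) with x by (field; lra).
    split; [|reflexivity]; split.
    * apply Rdiv_le_0_compat; lra.
    * apply Rmult_le_reg_r with (2 * PI); [lra|]; field_simplify; lra.
  + intros [r [_ ->]]; apply rim_loop_point; auto.
Qed.

(** * Cycles *)

Lemma cycle_rim (kap a m : R) (D : C -> Prop) : 0 < kap -> 0 < a ->
  0 < m < exp (- (1)) -> (forall p, p <> RtoC 0 -> D p) ->
  cycle D (vortex_flow kap a) (rim a m).
Proof.
intros k0 a0 Hm HD; assert (P := PI_RGT_0).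
assert (Hm' : 0 < m <= exp (- (1))) by lra.
assert (U : forall x, cos x ^ 2 + (- sin x) ^ 2 = 1).
{ intros x; rewrite <- (sin2_cos2 x); unfold Rsqr; ring. }
assert (lvl : forall x, m * - sin x < exp (- (1))).
{ intros x; assert (B := SIN_bound x); nra. }
destruct (loop_solution kap a m 2 cos (fun x => - sin x) (fun _ => 1))
  as [T [u [dT [mT [Tu [uT du]]]]]]; auto; try lra.
{ intros x; auto_derive; auto; ring. }
{ intros x; auto_derive; auto; ring. }
{ intros; lra. }
{ intros; apply continuous_const. }
{ intros x.
  assert (L : - 1 <= lambert (m * - sin x)).
  { apply lambert_ge_m1; split; [|left; apply lvl].
    assert (B := SIN_bound x); nra. }
  assert (1 <= sqrt (x ^ 2 + 1)).
  { rewrite <- sqrt_1 at 1; apply sqrt_le_1_alt; assert (Q := pow2_ge_0 x); lra. }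
  lra. }
set (g := fun t => loop_point a m (cos (u t)) (- sin (u t))).
exists g, (T (2 * PI) - T 0); split; [|split; [|split; [|split]]].
- apply global_is_maximal; intros t; split; [|apply du].
  apply HD, loop_point_neq_0; [exact a0|tauto|apply U].
- exists (T 0), (T PI); repeat split; unfold g; rewrite !uT; intros E.
  apply loop_point_inj in E; auto; destruct E as [E _].
  rewrite cos_0, cos_PI in E; lra.
- assert (T 0 < T (2 * PI)) by (apply mT; lra); lra.
- intros t; unfold g.
  rewrite (scalar_flow_periodic (loop_speed kap a m (fun x => - sin x) (fun _ => 1))
    T u (2 * PI)); auto.
  + rewrite cos_plus, sin_plus, cos_2PI, sin_2PI; f_equal; ring.
  + intros x; unfold loop_speed.
    rewrite sin_plus, cos_2PI, sin_2PI, Rmult_1_r, Rmult_0_r, Rplus_0_r.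
    reflexivity.
- intros z; split.
  + intros Hz; destruct (loop_point_of_rim a m z) as [c [s [H [-> _]]]]; try tauto.
    destruct (angle_exists c (- s)) as [x [_ [<- Es]]]; [rewrite <- H; ring|].
    exists (T x); repeat split; unfold g; rewrite uT, Es, Ropp_involutive; reflexivity.
  + intros [t [_ [_ ->]]]; apply rim_loop_point; auto.
Qed.

(** * The homoclinic loop *)

Lemma loop_point_top (a : R) : loop_point a (exp (- (1))) 0 1 = (0, a).
Proof.
unfold loop_point; rewrite Rmult_1_r, lambert_at_branch.
apply injective_projections; simpl; [ring|].
rewrite Rmult_1_r, Rmult_assoc, <- exp_plus, Rplus_opp_l, exp_0; ring.
Qed.

(** The height [a] is attained only where [m s = 1 / e], which a smaller [m]
    excludes. *)
Lemma snd_rim_lt (a m : R) (p : C) : 0 < a -> 0 < m < exp (- (1)) ->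
  rim a m p -> snd p < a.
Proof.
intros a0 Hm Hp; destruct (loop_point_of_rim a m p) as [c [s [H [-> _]]]]; try tauto.
rewrite snd_loop_point by (tauto || lra).
assert (L := lambert_lt_1 (m * s)).
assert (m * s < exp (- (1))) by (apply unit_le_1 in H; nra).
specialize (L H0); nra.
Qed.

(** The unit circle minus [(0, 1)] is run through clockwise by the inverse
    stereographic projection, whose angular velocity is [2 / (1 + x ^ 2)]. *)
Definition stereo_c (x : R) : R := - (2 * x) / (x ^ 2 + 1).
Definition stereo_s (x : R) : R := (x ^ 2 - 1) / (x ^ 2 + 1).

Lemma stereo_unit (x : R) : stereo_c x ^ 2 + stereo_s x ^ 2 = 1.
Proof. unfold stereo_c, stereo_s; field; nra. Qed.

Lemma stereo_onto (c s : R) : c ^ 2 + s ^ 2 = 1 -> s <> 1 ->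
  exists x, stereo_c x = c /\ stereo_s x = s.
Proof.
intros H N; exists (c / (s - 1)); unfold stereo_c, stereo_s.
assert (s1 : s - 1 <> 0) by lra.
assert (Ec : (c / (s - 1)) ^ 2 = (1 - s ^ 2) / (s - 1) ^ 2)
  by (replace (1 - s ^ 2) with (c ^ 2) by lra; field; exact s1).
rewrite Ec.
split; field; repeat split; try exact s1; nra.
Qed.

Lemma stereo_tends_to_top (a : R) (V : C -> Prop) : locally ((0, a) : C) V ->
  exists A, forall x, A < Rabs x ->
    V (loop_point a (exp (- (1))) (stereo_c x) (stereo_s x)).
Proof.
intros HV.
(* in the variable [k = 1 / x] the loop extends continuously by the point [(0, a)] *)
set (f := fun k => loop_point a (exp (- (1)))
  (- (2 * k) / (1 + k ^ 2)) ((1 - k ^ 2) / (1 + k ^ 2))).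
assert (f0 : f 0 = (0, a)).
{ rewrite <- loop_point_top; unfold f; f_equal; field. }
assert (cf : @continuous R_UniformSpace C_UniformSpace f 0).
{ apply (continuous_loop_point a _ (fun k => - (2 * k) / (1 + k ^ 2))
    (fun k => (1 - k ^ 2) / (1 + k ^ 2)));
    apply (ex_derive_continuous (V := R_NormedModule)); auto_derive; lra. }
rewrite <- f0 in HV; destruct (cf V HV) as [d Hd].
assert (d0 := cond_pos d).
exists (/ d); intros x Hx.
assert (i0 : 0 < / d) by (apply Rinv_0_lt_compat; exact d0).
assert (x0 : x <> 0) by (intros ->; rewrite Rabs_R0 in Hx; lra).
replace (stereo_c x) with (- (2 * / x) / (1 + (/ x) ^ 2))
  by (unfold stereo_c; field; split; nra).
replace (stereo_s x) with ((1 - (/ x) ^ 2) / (1 + (/ x) ^ 2))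
  by (unfold stereo_s; field; split; nra).
apply (Hd (/ x)).
change (Rabs (/ x - 0) < d); rewrite Rminus_0_r, Rabs_inv.
rewrite <- (Rinv_inv d); apply Rinv_lt_contravar; [|exact Hx].
apply Rmult_lt_0_compat; [exact i0|lra].
Qed.

Lemma rim_top (a : R) : 0 < a -> rim a (exp (- (1))) (0, a).
Proof.
intros a0; rewrite <- loop_point_top; apply rim_loop_point; [exact a0| |ring].
split; [apply exp_pos|lra].
Qed.

(** As time tends to either end the stereographic parameter leaves every bounded
    set, so the direction tends to [(0, 1)] and the point to [(0, a)]. *)
Lemma homoclinic_rim (kap a : R) (D : C -> Prop) : 0 < kap -> 0 < a ->
  (forall p, p <> RtoC 0 -> D p) ->
  homoclinic_streamline D (vortex_flow kap a) (0, a)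
    (fun p => rim a (exp (- (1))) p /\ p <> (0, a)).
Proof.
intros k0 a0 HD; assert (E0 := exp_pos (- (1))).
set (m := exp (- (1))) in *.
assert (Hm : 0 < m <= exp (- (1))) by (unfold m in *; lra).
assert (q0 : forall x : R, 0 < x ^ 2 + 1) by (intros x; nra).
assert (lvl : forall x, m * stereo_s x < exp (- (1))).
{ intros x; fold m; rewrite <- (Rmult_1_r m) at 2; apply Rmult_lt_compat_l; [exact E0|].
  apply Rmult_lt_reg_r with (x ^ 2 + 1); [apply q0|].
  unfold stereo_s; specialize (q0 x); field_simplify; lra. }
destruct (loop_solution kap a m 1 stereo_c stereo_s (fun x => 2 / (x ^ 2 + 1)))
  as [T [u [dT [mT [Tu [uT du]]]]]]; auto; try lra.
{ exact stereo_unit. }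
{ intros x; specialize (q0 x); unfold stereo_c, stereo_s; auto_derive; [simpl in q0; lra|].
  field; lra. }
{ intros x; specialize (q0 x); unfold stereo_c, stereo_s; auto_derive; [simpl in q0; lra|].
  field; lra. }
{ intros x; specialize (q0 x); apply Rdiv_lt_0_compat; lra. }
{ intros x; apply (ex_derive_continuous (V := R_NormedModule)); specialize (q0 x).
  auto_derive; simpl in q0; lra. }
{ (* the Hoelder bound at the branch point gives [(1 - y) ^ 2 <= 4 / (x ^ 2 + 1)] *)
  intros x; specialize (q0 x).
  assert (G := lambert_holder (exp (- (1))) (m * stereo_s x)).
  rewrite lambert_at_branch, Rabs_pos_eq in G by (specialize (lvl x); lra).
  fold m in G; specialize (lvl x).
  assert (L := lambert_le_1 (m * stereo_s x)).
  set (y := lambert (m * stereo_s x)) in *; clearbody y.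
  assert (Es : m - m * stereo_s x = m * (2 / (x ^ 2 + 1)))
    by (unfold stereo_s; field; lra).
  rewrite Es in G.
  assert (G2 : (1 - y) ^ 2 <= 4 / (x ^ 2 + 1)).
  { apply Rmult_le_reg_l with (m / 2); [lra|].
    replace (m / 2 * (4 / (x ^ 2 + 1))) with (m * (2 / (x ^ 2 + 1))) by (field; lra).
    lra. }
  assert (r0 := sqrt_lt_R0 _ q0); assert (rr := sqrt_sqrt _ (Rlt_le _ _ q0)).
  set (r := sqrt (x ^ 2 + 1)) in *.
  rewrite <- rr in *.
  replace (1 * (2 / (r * r)) * r) with (2 / r) by (field; lra).
  apply Rsqr_incr_0_var; [|left; apply Rdiv_lt_0_compat; lra].
  unfold Rsqr; replace (2 / r * (2 / r)) with (4 / (r * r)) by (field; lra).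
  simpl in G2; lra. }
set (g := fun t => loop_point a m (stereo_c (u t)) (stereo_s (u t))).
exists m_infty, p_infty, g; split; [|split; [|split; [|split]]].
- apply global_is_maximal; intros t; split; [|apply du].
  apply HD, loop_point_neq_0; [exact a0|tauto|apply stereo_unit].
- exists (T 0), (T 1); repeat split; unfold g; rewrite !uT; intros E.
  apply loop_point_inj in E; auto using stereo_unit; destruct E as [E _].
  unfold stereo_c in E; lra.
- intros V HV; destruct (stereo_tends_to_top a V HV) as [A HA].
  exists (T (Rmax 0 A)); split; [exact I|split; [exact I|]]; intros t Ht _.
  apply HA; destruct (Rle_lt_dec (u t) (Rmax 0 A)) as [l|l].
  + destruct l as [l|e]; [apply mT in l; rewrite Tu in l; lra|rewrite <- e, Tu in Ht; lra].
  + assert (M1 := Rmax_l 0 A); assert (M2 := Rmax_r 0 A).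
    rewrite Rabs_pos_eq; lra.
- intros V HV; destruct (stereo_tends_to_top a V HV) as [A HA].
  exists (T (- Rmax 0 A)); split; [exact I|split; [exact I|]]; intros t _ Ht.
  apply HA; destruct (Rle_lt_dec (- Rmax 0 A) (u t)) as [l|l].
  + destruct l as [l|e]; [apply mT in l; rewrite Tu in l; lra|rewrite e, Tu in Ht; lra].
  + assert (M1 := Rmax_l 0 A); assert (M2 := Rmax_r 0 A).
    rewrite Rabs_left; lra.
- intros z; split.
  + intros [Hz Nz]; destruct (loop_point_of_rim a m z) as [c [s [H [-> _]]]]; try tauto.
    destruct (stereo_onto c s H) as [x [<- <-]].
    { intros ->; apply Nz; replace c with 0 by nra; apply loop_point_top. }
    exists (T x); repeat split; unfold g; rewrite uT; reflexivity.
  + intros [t [_ [_ ->]]]; split.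
    * apply rim_loop_point; auto using stereo_unit.
    * intros E; apply (f_equal snd) in E; unfold g in E.
      rewrite snd_loop_point in E by auto using stereo_unit; simpl in E.
      assert (L := lambert_lt_1 _ (lvl (u t))); nra.
Qed.

(** * Separatrices *)

Lemma continuous_stream (kap a : R) (p : C) : p <> RtoC 0 ->
  @continuous C_UniformSpace R_UniformSpace (stream kap a) p.
Proof.
intros Hp; apply Cmod_gt_0 in Hp.
apply (continuous_ext (fun w : C => kap * (- snd w + a * ln (Cmod w)))).
{ intros w; reflexivity. }
apply (continuous_scal_r (V := R_NormedModule) kap
  (fun w : C => - snd w + a * ln (Cmod w))).
apply (continuous_plus (V := R_NormedModule) (fun w : C => - snd w)).
- apply (continuous_opp (V := R_NormedModule) (fun w : C => snd w)).
  apply continuous_snd.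
- apply (continuous_scal_r (V := R_NormedModule) a (fun w : C => ln (Cmod w))).
  apply (continuous_comp Cmod ln); [apply continuous_Cmod|].
  apply (ex_derive_continuous (V := R_NormedModule)); auto_derive; exact Hp.
Qed.

(** The stream function is constant on the solution and continuous at its
    limit [p0], hence takes the value that it has there. *)
Lemma separatrix_stream (kap a : R) (D : C -> Prop) (p0 : C) (S : C -> Prop) :
  (forall p, D p -> p <> RtoC 0) -> p0 <> RtoC 0 ->
  separatrix D (vortex_flow kap a) p0 S ->
  forall p, S p -> D p /\ stream kap a p = stream kap a p0.
Proof.
intros HD H0 [s [t [g [[Hg _] [_ [Hlim HS]]]]]] p Hp.
apply HS in Hp; destruct Hp as [r [H1 [H2 ->]]].
split; [destruct Hg as [_ Hg]; apply (Hg r H1 H2)|].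
apply NNPP; intros N.
assert (d0 : 0 < Rabs (stream kap a (g r) - stream kap a p0))
  by (apply Rabs_pos_lt; lra).
set (d := Rabs (stream kap a (g r) - stream kap a p0)) in *.
assert (HV : @locally C_UniformSpace p0
  (fun w => Rabs (stream kap a w - stream kap a p0) < d)).
{ exact (proj1 (filterlim_locally _ _) (continuous_stream kap a p0 H0)
    (mkposreal d d0)). }
assert (K : exists r' : R, Rbar_lt s r' /\ Rbar_lt r' t /\
  Rabs (stream kap a (g r') - stream kap a p0) < d).
{ destruct Hlim as [L|L]; destruct (L _ HV) as [t0 [A [B H]]].
  - destruct (Rbar_lt_between t0 t B) as [r' [C1 C2]].
    exists r'; split; [eapply Rbar_lt_trans; [exact A|exact C1]|].
    split; [exact C2|]; apply H; assumption.
  - destruct (Rbar_lt_between s t0 A) as [r' [C1 C2]].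
    exists r'; split; [exact C1|].
    split; [eapply Rbar_lt_trans; [exact C2|exact B]|]; apply H; assumption. }
destruct K as [r' [A [B K]]].
rewrite (stream_constant kap a D s t g HD Hg r' r A B H1 H2) in K.
unfold d in K; lra.
Qed.

(** * The flow *)

(** Every point of the eye lies on a rim: its level fixes [m], and the height
    below [a] puts it on the closed part of that level. *)
Lemma vortex_eye_filled (kap a : R) (D : C -> Prop) (p : C) : 0 < kap -> 0 < a ->
  (forall p, p <> RtoC 0 -> D p) ->
  eye a (exp (- (1))) p -> p <> RtoC 0 ->
  exists G : C -> Prop, cycle D (vortex_flow kap a) G /\ G p /\
    (forall w, G w -> eye a (exp (- (1))) w) /\ surrounds G (RtoC 0).
Proof.
intros k0 a0 HD [H1 H2] Hp; apply Cmod_gt_0 in Hp.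
assert (E0 := exp_pos (snd p / a)).
set (m := Cmod p / (a * exp (snd p / a))).
assert (ae : 0 < a * exp (snd p / a)) by (apply Rmult_lt_0_compat; assumption).
assert (Em : Cmod p = a * m * exp (snd p / a)) by (unfold m; field; lra).
assert (Hm : 0 < m < exp (- (1))).
{ split; [apply Rdiv_lt_0_compat; assumption|].
  apply Rmult_lt_reg_r with (a * exp (snd p / a)); [exact ae|]; lra. }
exists (rim a m); split; [apply cycle_rim; assumption|].
split; [split; [lra|exact Em]|split].
- intros w Hw; split; [apply (snd_rim_lt a m w a0 Hm Hw)|].
  destruct Hw as [_ ->]; apply Rmult_lt_compat_r; [apply exp_pos|].
  apply Rmult_lt_compat_l; lra.
- exists (eye a m); split; [apply bounds_rim_eye; [exact a0|lra]|].
  apply eye_0; tauto.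
Qed.

Theorem theorem3p3 (hbar M k delta : R)
    (hhbar : 0 < hbar) (hM : 0 < M) (hk : 0 < k)
    (hdelta : 0 <= delta <= 1 / 2) :
  let D := current_domain delta in
  let J := current hbar M k delta in
  let F := potential hbar M k delta in
  let psi := stream_function hbar M k delta in
  let z0 : C := (0, delta / k) in
  (forall (U : C -> Prop) (lg : C -> C), log_branch U lg ->
     complex_potential U J (F lg) /\
     (forall z, U z -> Im (F lg z) = psi z)) /\
  (delta = 0 -> forall lg : C -> C,
     complex_potential (fun _ => True) J (F lg)) /\
  (delta = 0 ->
     (forall S : C -> Prop,
        streamline D J S <->
        exists c0 : R, forall p : C, S p <-> snd p = c0) /\
     (forall p : C, J p = (- (hbar * k / M), 0))) /\
  (0 < delta ->
     (forall S : C -> Prop, streamline D J S ->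
        exists c : R, forall p : C, S p -> psi p = c) /\
     (forall S : C -> Prop, streamline D J S ->
        streamline D J (fun p : C => S (- fst p, snd p))) /\
     (forall p : C, stagnation_point D J p <-> p = z0) /\
     (forall (U : C -> Prop) (lg : C -> C), log_branch U lg ->
        forall z : C, U z ->
          (@is_derive C_AbsRing C_NormedModule (F lg) z (RtoC 0) <-> z = z0)) /\
     saddle D J z0 /\
     (forall S : C -> Prop, separatrix D J z0 S ->
        forall p : C, S p -> separatrix_level hbar M k delta p) /\
     (exists S N : C -> Prop,
        homoclinic_streamline D J z0 S /\
        simple_closed_curve (fun p : C => S p \/ p = z0) /\
        bounds (fun p : C => S p \/ p = z0) N /\
        N (RtoC 0) /\
        (forall p : C, N p -> p <> RtoC 0 ->
           exists G : C -> Prop,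
             cycle D J G /\ G p /\ (forall w : C, G w -> N w) /\
             surrounds G (RtoC 0)))).
Proof.
intros D J F psi z0.
assert (k0 : 0 < hbar * k / M)
  by (apply Rdiv_lt_0_compat; [apply Rmult_lt_0_compat|]; assumption).
assert (uniform : delta = 0 -> forall p, J p = (- (hbar * k / M), 0)).
{ intros d0 p; unfold J, current; rewrite d0.
  apply injective_projections; simpl; unfold Rdiv; ring. }
split; [|split; [|split]].
- intros U lg Hlg; split.
  + split; [apply Hlg|]; intros z Hz.
    apply (potential_derive hbar M k delta U lg z Hlg Hz).
  + intros z Hz; assert (R1 := Re_log_branch U lg z Hlg Hz).
    unfold F, potential, psi, stream_function.
    change (sqrt (fst z ^ 2 + snd z ^ 2)) with (Cmod z); rewrite <- R1.
    destruct (lg z) as [l1 l2], z as [x y]; simpl; ring.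
- intros d0 lg; split; [apply open_true|]; intros z _.
  rewrite (uniform d0 z).
  assert (Hid : @is_derive C_AbsRing C_NormedModule (fun w => w) z (RtoC 1)).
  { apply is_derive_C_eps; intros e e0; exists 1; split; [lra|]; intros w _.
    replace (w - z - (w - z) * 1)%C with (RtoC 0) by ring.
    rewrite Cmod_0; apply Rmult_le_pos; [lra|apply Cmod_ge_0]. }
  assert (H := is_derive_C_affine_comb (fun w => w) (- RtoC (hbar * k / M))%C
    0%C z 1%C Hid).
  replace ((fst (- (hbar * k / M), 0), - snd (- (hbar * k / M), 0)) : C)
    with (- RtoC (hbar * k / M) + 0 * 1)%C
    by (apply injective_projections; simpl; ring).
  eapply is_derive_ext; [|exact H].
  intros w; unfold F, potential; rewrite d0.
  apply injective_projections; simpl; unfold Rdiv; ring.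
- intros d0; split; [|apply uniform, d0].
  apply (streamline_constant_field D J (- (hbar * k / M))).
  + lra.
  + intros p; left; exact d0.
  + apply uniform, d0.
- intros d0; assert (a0 : 0 < delta / k) by (apply Rdiv_lt_0_compat; assumption).
  assert (HD : forall p, D p <-> p <> RtoC 0).
  { intros p; split; [intros [e|H]; [lra|exact H]|right; assumption]. }
  assert (z00 : z0 <> RtoC 0) by (intros E; injection E; lra).
  assert (stag : forall p, (p <> RtoC 0 /\ J p = RtoC 0) <-> p = z0)
    by (intros p; apply (stagnation_iff (hbar * k / M) (delta / k) p k0 a0)).
  split; [|split; [|split; [|split; [|split; [|split]]]]].
  + intros S [s [t [g [[Hg _] HS]]]].
    destruct (Rbar_lt_between s t (proj1 Hg)) as [r [H1 H2]].
    exists (psi (g r)); intros p Hp; apply HS in Hp.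
    destruct Hp as [r' [H3 [H4 ->]]].
    apply (stream_constant (hbar * k / M) (delta / k) D s t g); auto.
    intros p; apply HD.
  + intros S; apply (streamline_reflect (hbar * k / M) (delta / k) D S).
    intros p Hp; apply HD; apply HD in Hp; intros E; apply Hp.
    apply (f_equal fst) in E as E1; apply (f_equal snd) in E as E2.
    simpl in E1, E2; apply injective_projections; simpl; lra.
  + intros p; unfold stagnation_point; rewrite HD; apply stag.
  + intros U lg Hlg z Hz.
    destruct (potential_derive hbar M k delta U lg z Hlg Hz) as [zn0 HF].
    rewrite <- (stag z); split.
    * intros H; split; [exact zn0|].
      assert (E := is_derive_C_unique _ _ _ _ HF H).
      apply (f_equal fst) in E as E1; apply (f_equal snd) in E as E2.
      simpl in E1, E2; apply injective_projections; [exact E1|].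
      simpl; lra.
    * intros [_ E].
      change (current hbar M k delta z = RtoC 0) in E; rewrite E in HF.
      replace (RtoC 0) with ((fst (RtoC 0), - snd (RtoC 0)) : C)
        by (apply injective_projections; simpl; ring).
      exact HF.
  + apply (saddle_vortex_flow (hbar * k / M) (delta / k) D k0 a0).
    apply HD; exact z00.
  + intros S HS p Hp.
    destruct (separatrix_stream (hbar * k / M) (delta / k) D z0 S
      (fun p => proj1 (HD p)) z00 HS p Hp) as [Dp E].
    split; [apply HD; exact Dp|].
    change (stream (hbar * k / M) (delta / k) p
      = hbar * delta / M * (ln (delta / k) - 1)).
    rewrite E; unfold stream, z0; simpl fst; simpl snd.
    replace (0 ^ 2 + (delta / k) ^ 2) with ((delta / k) ^ 2) by ring.
    rewrite sqrt_pow2 by lra; field; lra.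
  + set (a := delta / k) in *; set (m := exp (- (1))).
    assert (Hm : 0 < m <= exp (- (1))) by (split; [apply exp_pos|apply Rle_refl]).
    assert (ES : forall p, (rim a m p /\ p <> z0) \/ p = z0 <-> rim a m p).
    { intros p; split.
      - intros [[H _]| ->]; [exact H|apply rim_top, a0].
      - intros H; destruct (classic (p = z0)); tauto. }
    exists (fun p => rim a m p /\ p <> z0), (eye a m).
    split; [|split; [|split; [|split]]].
    * apply (homoclinic_rim (hbar * k / M) a D k0 a0 (fun p => proj2 (HD p))).
    * destruct (simple_closed_curve_rim a m a0 Hm) as [c [H1 [H2 [H3 H4]]]].
      exists c; split; [exact H1|split; [exact H2|split; [exact H3|]]].
      intros z; rewrite ES; apply H4.
    * destruct (bounds_rim_eye a m a0 Hm) as [H1 [H2 [H3 H4]]].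
      split; [exact H1|split; [exact H2|split; [exact H3|]]].
      intros z; rewrite ES; apply H4.
    * apply eye_0; [exact a0|apply Hm].
    * intros p Hp Np.
      apply (vortex_eye_filled (hbar * k / M) a D p k0 a0 (fun p => proj2 (HD p)) Hp Np).
Qed.
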